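(* Let $d\ge 1$ be an integer, let $c\in\{1,2,\ldots,d\}$ and let $p>1$ be a real number. There exists a constant $C>0$, not depending on $w$, $f$ or $t$, such that the following holds. For every weight $w$ on $\mathbb{R}^d$, with $W=\mathfrak{M}_c\mathfrak{M}_{c-1}\cdots\mathfrak{M}_1 w$, for every locally integrable function $f$ on $\mathbb{R}^d$ and every $t>0$, $$ w\bigl(\{x\in\mathbb{R}^d:\ \mathfrak{M}_c f(x)>t\}\bigr)^{\frac1p}\le \frac{C}{t}\,\|f\|_{L^p(\mathbb{R}^d,W)}. $$
   Context: A weight on $\mathbb{R}^d$ is a non-negative, locally integrable function. For a measurable set $E\subset\mathbb{R}^d$ and a weight $w$, $w(E)=\int_E w\,dx$, and $|E|$ is the Lebesgue measure of $E$. For a non-negative measurable $W$ (possibly taking the value $+\infty$, with the convention $0\cdot\infty=0$), $\|f\|_{L^p(\mathbb{R}^d,W)}=\left(\int_{\mathbb{R}^d}|f|^pW\,dx\right)^{1/p}\in[0,\infty]$. A rectangle in $\mathbb{R}^d$ means a product of $d$ bounded intervals of positive length (sides parallel to the coordinate axes). For $c\in\{1,\ldots,d\}$, $\mathcal{R}_c$ denotes the set of all such rectangles having complexity $c$: those for which there are $\alpha_1,\ldots,\alpha_c>0$ (varying with the rectangle) such that each of the $d$ sidelengths equals one of $\alpha_1,\ldots,\alpha_c$. Thus $\mathcal{R}_1$ is the set of axis-parallel cubes and $\mathcal{R}_d$ is the set of all axis-parallel rectangles. The maximal operator $\mathfrak{M}_c$ is defined by $$ \mathfrak{M}_c f(x)=\sup_{R\in\mathcal{R}_c}\mathbf{1}_R(x)\,\frac{1}{|R|}\int_R|f|\,dy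 , $$ with values in $[0,\infty]$, where $\mathbf{1}_R$ is the characteristic function of $R$. In compositions such as $\mathfrak{M}_c\mathfrak{M}_{c-1}\cdots\mathfrak{M}_1w$ (apply $\mathfrak{M}_1$ first, then $\mathfrak{M}_2$, and so on up to $\mathfrak{M}_c$), the same formula is applied to $[0,\infty]$-valued measurable functions. *)

(* Defs.v *)
From HB Require Import structures.
From mathcomp Require Import all_boot all_order all_algebra.
From mathcomp Require Import all_classical all_reals all_analysis.
Import Order.TTheory GRing.Theory Num.Theory.
Import numFieldNormedType.Exports.

Set Implicit Arguments.
Unset Strict Implicit.
Unset Printing Implicit Defensive.

Local Open Scope classical_set_scope.
Local Open Scope ring_scope.
Local Open Scope ereal_scope.

Section product_step.
Context d (T : measurableType d) (R : realType) (n : nat).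
Variable m : {sigma_finite_measure set T -> \bar R}.
Variable mu : {sigma_finite_measure set (n.-tuple T) -> \bar R}.

Let cons_pair (x : T * n.-tuple T) : n.+1.-tuple T :=
  [the n.+1.-tuple T of x.1 :: x.2].

Let uncons (t : n.+1.-tuple T) : T * n.-tuple T :=
  (thead t, [tuple of behead t]).

Let cons_pairK : cancel cons_pair uncons.
Proof. by move=> [x t]; congr pair; apply/val_inj. Qed.

Let measurable_cons_pair : measurable_fun [set: T * n.-tuple T] cons_pair.
Proof. exact: measurable_cons. Qed.

Let measurable_uncons : measurable_fun [set: n.+1.-tuple T] uncons.
Proof.
apply: measurable_fun_pair; last exact: measurable_behead.
exact: measurable_tnth.
Qed.

Definition product_step : set (n.+1.-tuple T) -> \bar R :=
  pushforward (m \x mu) cons_pair.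

Let product_step0 : product_step set0 = 0.
Proof. by rewrite /product_step /pushforward preimage_set0 measure0. Qed.

Let product_step_ge0 A : 0 <= product_step A.
Proof. by rewrite /product_step /pushforward measure_ge0. Qed.

Let product_step_sigma_additive : semi_sigma_additive product_step.
Proof.
move=> F mF tF mUF; rewrite /product_step /pushforward preimage_bigcup.
apply: measure_semi_sigma_additive.
- by move=> k; rewrite -[X in measurable X]setTI; exact: measurable_cons_pair.
- apply/trivIsetP => /= i j _ _ ij; rewrite -preimage_setI.
  by move/trivIsetP : tF => /(_ _ _ _ _ ij) ->//; rewrite preimage_set0.
- rewrite -preimage_bigcup -[X in measurable X]setTI.
  exact: measurable_cons_pair.
Qed.

HB.instance Definition _ := isMeasure.Build _ _ _ product_step
  product_step0 product_step_ge0 product_step_sigma_additive.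

Let product_step_sigma_finite : sigma_finite setT product_step.
Proof.
have /sigma_finiteP[F [TF ndF Foo]] := sigma_finiteT m.
have /sigma_finiteP[G [TG ndG Goo]] := sigma_finiteT mu.
exists (fun k => uncons @^-1` (F k `*` G k)).
  apply/esym/seteqP; split => // t _.
  have [i _ Fi] : (\bigcup_i F i) (uncons t).1 by rewrite -TF.
  have [j _ Gj] : (\bigcup_j G j) (uncons t).2 by rewrite -TG.
  exists (maxn i j) => //; split.
    by move: Fi; exact/subsetPset/ndF/leq_maxl.
  by move: Gj; exact/subsetPset/ndG/leq_maxr.
move=> k; have [mF Fkoo] := Foo k; have [mG Gkoo] := Goo k; split.
  rewrite -[X in measurable X]setTI; apply: measurable_uncons => //.
  exact: measurableX.
rewrite /product_step /pushforward -comp_preimage.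
rewrite (_ : uncons \o cons_pair = id) ?preimage_id; last exact/funext.
by rewrite product_measure1E// lte_mul_pinfty// ge0_fin_numE.
Qed.

HB.instance Definition _ := Measure_isSigmaFinite.Build _ _ _ product_step
  product_step_sigma_finite.

End product_step.

(* Lebesgue measure on the Borel sets of R^n: the n-fold product of
   lebesgue_measure, on the product sigma-algebra of n.-tuple R. *)
Fixpoint borel_lebesgue (R : realType) (n : nat) :
    {sigma_finite_measure set (n.-tuple (measurableTypeR R)) -> \bar R} :=
  match n return
    {sigma_finite_measure set (n.-tuple (measurableTypeR R)) -> \bar R} with
  | 0 => \d_([tuple] : 0.-tuple (measurableTypeR R))
  | n'.+1 => product_step lebesgue_measure (borel_lebesgue R n')
  end.

(* R^d with the sigma-algebra of Lebesgue measurable sets (and not only of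
   Borel sets): the Caratheodory sets of the outer Lebesgue measure. *)
Definition Rd (R : realType) (d : nat) : measurableType _ :=
  caratheodory_type (borel_lebesgue R d)^*%mu.

Definition leb (R : realType) (d : nat) : {measure set (Rd R d) -> \bar R} :=
  @completed_measure_extension _ _ R (borel_lebesgue R d).

Section maximal.
Context {R : realType} {d : nat}.
Local Notation Rd := (Rd R d).
Local Notation leb := (leb R d).

(* Tuples carry no topology in the library; that of R^d is the one of 'rV_d. *)
Definition compactRd (K : set Rd) :=
  compact [set (\row_i tnth x i : 'rV[R]_d) | x in K].

Definition loc_integrable (f : Rd -> R) :=
  measurable_fun [set: Rd] f /\
  forall K, compactRd K -> \int[leb]_(x in K) `|f x|%:E < +oo.

Definition weight (w : Rd -> R) :=
  (forall x, 0 <= w x)%R /\ loc_integrable w.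

Definition weighted_measure (w : Rd -> R) (E : set Rd) : \bar R :=
  \int[leb]_(x in E) (w x)%:E.

Definition weighted_norm (p : R) (W : Rd -> \bar R) (f : Rd -> R) : \bar R :=
  (\int[leb]_x ((`|f x| `^ p)%:E * W x)) `^ p^-1.

(* The Booleans l i and r i choose, for each side, which endpoints belong to
   the interval. *)
Definition box (a b : 'I_d -> R) (l r : 'I_d -> bool) : set Rd :=
  [set x | forall i, tnth x i \in Interval (BSide (l i) (a i)) (BSide (r i) (b i))].

Definition rectangles (c : nat) : set (set Rd) :=
  [set Q | exists a b : 'I_d -> R, exists l r : 'I_d -> bool,
    [/\ forall i, (a i < b i)%R,
        Q = box a b l r &
        exists alpha : 'I_c -> R, (forall k, 0 < alpha k)%R /\
          forall i, exists k, (b i - a i)%R = alpha k]].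

Definition average (f : Rd -> \bar R) (Q : set Rd) : \bar R :=
  (leb Q)^-1 * \int[leb]_(y in Q) `|f y|.

Definition maximal (c : nat) (f : Rd -> \bar R) (x : Rd) : \bar R :=
  ereal_sup [set (\1_Q x)%:E * average f Q | Q in rectangles c].

Fixpoint iter_maximal (c : nat) (w : Rd -> \bar R) : Rd -> \bar R :=
  match c with
  | 0 => w
  | c'.+1 => maximal c'.+1 (iter_maximal c' w)
  end.

End maximal.

(* Main.v *)
(* Induction on the complexity [c], on a finite grid. Let finitely many boxes of complexity [c + 1]
   carry averages of [f] above [t], all with the same set [G] of longest sides, and select them
   greedily in decreasing order of the longest side: a box is kept when less than half of it is covered
   by the boxes kept before it. Let [R*] be [R] dilated by 3 in the directions of [G]. In these
   directions a kept larger box which meets a rejected box [R] has a dilation covering [R], so the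
   union [T] of the dilations has density at least 1/2 not only in [R] but also in the parts of [R]
   whose sides in the directions of [G] are shortened to another sidelength of [R]. These parts have
   complexity [c], and the induction hypothesis for the indicator of [T] gives
     w(all boxes) <= C (M_c ... M_1 w)(T) <= C 3^d sum_R |R| v_R
   over the kept boxes, where v_R is the average of M_c ... M_1 w over R*, so v_R <= W on R for
   W = M_(c+1) ... M_1 w. Finally t^p v_R <= (average of f W^(1/p) over R)^p, and as the kept boxes
   have disjoint parts of at least half their size, sum_R |R| t^p v_R is controlled by the
   unweighted L^p bound of the strong maximal function of f W^(1/p).

   The superlevel set is an increasing union of unions of dyadic boxes; the grid functions are the
   means of [w] and [f] on the cells, and lower bounds of the iterated maximal functions there. *)
Require Import Defs.
From mathcomp Require Import all_boot all_order all_algebra.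
From mathcomp Require Import all_classical all_reals all_analysis.
From mathcomp Require Import measurable_realfun.
From mathcomp Require Import zify ring lra.
Import Order.TTheory GRing.Theory Num.Theory.
Import numFieldNormedType.Exports.

Set Implicit Arguments.
Unset Strict Implicit.
Unset Printing Implicit Defensive.

(** * Maximal functions on an interval of integers *)

Section one_sided_maximal.
Context {R : realType}.
Local Open Scope ring_scope.

Lemma powR_diff_le (a b p : R) : 0 <= a -> 0 <= b -> 1 < p ->
  b `^ p - a `^ p <= p / (p - 1) * (b * (b `^ (p - 1) - a `^ (p - 1))).
Proof.
move=> a0 b0 p1.
have p0 : 0 < p by lra.
have p10 : 0 < p - 1 by lra.
have := @conjugate_powR R b (a `^ (p - 1)) p (p / (p - 1)) b0 (powR_ge0 _ _) p0.
rewrite -powRrM invf_div.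
have -> : (p - 1) * (p / (p - 1)) = p by field; lra.
move=> /(_ (divr_gt0 p0 p10)).
have -> : p^-1 + (p - 1) / p = 1 by field; lra.
move=> /(_ erefl) H.
have bb : b * b `^ (p - 1) = b `^ p by exact: mulr_powRB1.
rewrite mulrBr bb -(ler_pM2l p10) -subr_ge0.
move: H; rewrite -(ler_pM2l p0) -subr_ge0.
set u := b `^ p; set v := a `^ p; set w := b * _.
have -> : p * (u / p + v * ((p - 1) / p)) - p * w = u + v * (p - 1) - p * w.
  by field; lra.
have -> : (p - 1) * (p / (p - 1) * (u - w)) - (p - 1) * (u - v) =
  u + v * (p - 1) - p * w by field; lra.
by [].
Qed.

(* Abel summation over the values of [M], performed one level at a time. *)
Lemma weak_type_moment_above (T : finType) (M phi : T -> R) (p : R) :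
  1 < p -> (forall x, 0 <= phi x) ->
  (forall l, 0 < l -> l * #|[pred x | l <= M x]|%:R <= \sum_(x | l <= M x) phi x) ->
  forall a, 0 <= a ->
  \sum_(x | a < M x) (M x `^ p - a `^ p) <=
  p / (p - 1) * \sum_(x | a < M x) phi x * (M x `^ (p - 1) - a `^ (p - 1)).
Proof.
move=> p1 phi0 wt a; have [n] := ubnP #|[pred x | a < M x]|.
elim: n a => // n IHn a ltn a0.
have [x0 ax0|none] := pickP [pred x | a < M x]; last first.
  by rewrite !big_pred0// mulr0.
have pp0 : 0 <= p / (p - 1) by apply: divr_ge0; lra.
(* [b] is the lowest value of [M] above [a], so [a < M x] and [b <= M x] are the same condition.
   Above [b] fewer points remain, and the induction applies. *)
case: (@arg_minP _ _ _ x0 [pred x | a < M x] M ax0) => y /= ay ymin.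
set b := M y in ay ymin.
have b0 : 0 < b by exact: le_lt_trans ay.
have bE x : (a < M x) = (b <= M x).
  by apply/idP/idP => [/ymin//|]; exact: lt_le_trans.
rewrite !(eq_bigl _ _ bE).
have IH : \sum_(x | b < M x) (M x `^ p - b `^ p) <=
  p / (p - 1) * \sum_(x | b < M x) phi x * (M x `^ (p - 1) - b `^ (p - 1)).
  apply: IHn; last exact: ltW.
  rewrite -ltnS; apply: leq_trans ltn; rewrite ltnS.
  apply: proper_card; apply/properP; split.
    by apply/fintype.subsetP => x; rewrite !inE; apply: lt_trans.
  by exists y; rewrite !inE ?ltxx.
have split_level (F G : T -> R) : (forall x, M x = b -> F x = G x) ->
    \sum_(x | b <= M x) F x = \sum_(x | b < M x) (F x - G x) + \sum_(x | b <= M x) G x.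
  move=> FG; rewrite sumrB -addrA.
  rewrite (bigID (fun x => b < M x)) /= [X in _ = _ + (_ + X)](bigID (fun x => b < M x)) /=.
  have eqlt x : (b <= M x) && (b < M x) = (b < M x).
    by rewrite andb_idl// => /ltW.
  rewrite !(eq_bigl _ _ eqlt) addKr.
  congr (_ + _); apply: eq_bigr => x; rewrite -leNgt => /andP[xb bx].
  by apply: FG; apply/eqP; rewrite eq_le bx xb.
rewrite (split_level _ (fun=> b `^ p - a `^ p)); last by move=> x ->.
rewrite [X in _ <= _ * X](split_level _ (fun x => phi x * (b `^ (p - 1) - a `^ (p - 1))));
  last by move=> x ->.
rewrite mulrDr; apply: lerD.
  rewrite (eq_bigr (fun x => M x `^ p - b `^ p)); last by move=> x _; lra.
  rewrite [X in _ <= _ * X](eq_bigr (fun x => phi x * (M x `^ (p - 1) - b `^ (p - 1))))//.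
  by move=> x _; rewrite -mulrBr; congr (_ * _); lra.
have mono : 0 <= b `^ (p - 1) - a `^ (p - 1).
  rewrite subr_ge0 ge0_ler_powR ?nnegrE//; [lra|exact: ltW|exact: ltW].
(* There remains the band between [a] and [b], of constant height over the points with [b <= M x]:
   the weak type hypothesis is used at [l = b]. *)
rewrite sumr_const -mulr_suml -[X in X <= _]mulr_natr.
apply: (@le_trans _ _ (p / (p - 1) * (b * (b `^ (p - 1) - a `^ (p - 1))) * #|[pred x | b <= M x]|%:R)).
  apply: ler_wpM2r; first exact: ler0n.
  by apply: powR_diff_le => //; exact: ltW.
move: pp0 mono; move: (p / _) => K; move: (_ - _) => D K0 D0.
have -> m : K * (b * D) * m = K * (b * m * D) by ring.
by rewrite ler_wpM2l// ler_wpM2r// wt.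
Qed.

(** Young's inequality with a parameter, by comparing [x] with [e * y]: the first term suffices when
    [x] is the smaller one, the second is added for the other case. *)
Lemma powR_mul_le (p e x y : R) : 1 < p -> 0 < e -> 0 <= x -> 0 <= y ->
  x * y `^ (p - 1) <= e * y `^ p + e `^ (1 - p) * x `^ p.
Proof.
move=> p1 e0 x0 y0; have p0 : 0 < p by lra.
have [xy|yx] := leP x (e * y).
  apply: (@le_trans _ _ (e * y * y `^ (p - 1))); first by rewrite ler_wpM2r ?powR_ge0.
  by rewrite -mulrA mulr_powRB1// lerDl mulr_ge0 ?powR_ge0.
have x_gt0 : 0 < x by apply: le_lt_trans yx; rewrite mulr_ge0// ltW.
apply: (@le_trans _ _ (x * (x / e) `^ (p - 1))).
  rewrite ler_wpM2l// ge0_ler_powR ?nnegrE//; first by lra.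
    by rewrite divr_ge0// ltW.
  by rewrite ler_pdivlMr// mulrC ltW.
rewrite powRM ?invr_ge0 ?(ltW e0)// mulrA mulr_powRB1// -powR_inv1 ?(ltW e0)//.
rewrite -powRrM mulN1r opprB mulrC lerDr mulr_ge0 ?powR_ge0//; exact: ltW.
Qed.

(** The hypothesis is of Doob's type: only the mass of [phi] on the level set itself enters. The
    moment bound at level 0 gives [K] times the sum of phi M^(p-1); since [K * e] is 1/2, Young's
    inequality then lets half of the left side be absorbed, all sums being finite. *)
Lemma weak_type_strong (p : R) : 1 < p -> exists A : R, 0 < A /\
  forall (T : finType) (M phi : T -> R), (forall x, 0 <= M x) ->
  (forall x, 0 <= phi x) ->
  (forall l, 0 < l -> l * #|[pred x | l <= M x]|%:R <= \sum_(x | l <= M x) phi x) ->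
  \sum_x M x `^ p <= A * \sum_x phi x `^ p.
Proof.
move=> p1; pose K := p / (p - 1); pose e := (2 * K)^-1.
have p0 : 0 < p by lra.
have K0 : 0 < K by apply: divr_gt0; lra.
have e0 : 0 < e by rewrite invr_gt0 mulr_gt0.
exists (2 * K * e `^ (1 - p)); split; first by apply: mulr_gt0; [apply: mulr_gt0|exact: powR_gt0].
move=> T M phi M0 phi0 /(weak_type_moment_above p1 phi0) /(_ 0 (lexx 0)).
have pn0 : p != 0 by lra.
have p1n0 : p - 1 != 0 by lra.
rewrite !powR0// -/K => H.
have H1 : \sum_x M x `^ p <= K * \sum_x phi x * M x `^ (p - 1).
  rewrite (bigID (fun x => 0 < M x)) /= [X in _ + X]big1 ?addr0 => [|x].
    apply: le_trans (le_trans H _); first by apply: ler_sum => x _; rewrite subr0.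
    rewrite ler_wpM2l ?(ltW K0)//.
    rewrite [X in _ <= X](bigID (fun x => 0 < M x)) /= -[X in X <= _]addr0.
    apply: lerD; first by apply: ler_sum => x _; rewrite subr0.
    by apply: sumr_ge0 => x _; rewrite mulr_ge0 ?powR_ge0.
  rewrite -leNgt => Mx; have -> : M x = 0 by apply/eqP; rewrite eq_le Mx M0.
  by rewrite powR0.
have H2 : \sum_x phi x * M x `^ (p - 1) <=
    e * \sum_x M x `^ p + e `^ (1 - p) * \sum_x phi x `^ p.
  rewrite !mulr_sumr -big_split /=; apply: ler_sum => x _.
  exact: powR_mul_le.
have H3 := le_trans H1 (ler_wpM2l (ltW K0) H2).
have eK : K * e = 2^-1 by rewrite /e invfM mulrCA divff ?mulr1// gt_eqF.
move: H3; rewrite mulrDr mulrA eK mulrA.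
set a := \sum_x M x `^ p; set b := \sum_x phi x `^ p; lra.
Qed.

Definition left_maximal (phi : nat -> R) (z : nat) : R :=
  \big[Num.max/0]_(a < z.+1) ((\sum_(a <= i < z.+1) phi i) / (z.+1 - a)%:R).

(* The excess [e] obeys Lindley's recursion [e (z + 1) = max 0 (e z + phi z - l)];
   it dominates all sums of [phi - l] over intervals ending at [z]. *)
Lemma left_maximal_weak (phi : nat -> R) (N : nat) (l : R) :
  (forall i, 0 <= phi i) -> 0 < l ->
  l * #|[pred i : 'I_N | l <= left_maximal phi i]|%:R <=
  \sum_(i < N | l <= left_maximal phi i) phi i.
Proof.
move=> phi0 l0.
pose e := nat_rect (fun=> R) 0 (fun z ez => Num.max 0 (ez + phi z - l)).
have eS z : e z.+1 = Num.max 0 (e z + phi z - l) by [].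
have e0 z : 0 <= e z by case: z => [|z]; rewrite ?eS ?le_max lexx.
have esum a z : (a <= z)%N -> \sum_(a <= i < z) (phi i - l) <= e z.
  move=> /subnK <-; elim: (z - a)%N => [|k IHk]; first by rewrite big_geq.
  rewrite addSn big_nat_recr ?leq_addl// eS le_max; apply/orP; right.
  by move: IHk => /=; lra.
(* Off the level set [phi z] is below [l], and the excess does not grow. On it the maximum in the
   recursion is its second entry, since otherwise all sums of [phi - l] ending at [z] would be
   negative. Summing these steps from [e 0 = 0] to [e N >= 0] gives the claim. *)
have step z : e z.+1 - e z <= if l <= left_maximal phi z then phi z - l else 0.
  case: ifPn => [lz|]; last first.
    rewrite -ltNge => zl; rewrite subr_le0 eS ge_max e0 /=.
    have : phi z <= left_maximal phi z.
      rewrite /left_maximal; apply: le_trans (le_bigmax _ _ ord_max) => /=.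
      by rewrite big_nat1 subSnn divr1.
    by have := e0 z; lra.
  rewrite eS; suff : 0 <= e z + phi z - l.
    by case: ltP; lra.
  rewrite leNgt; apply/negP => neg; move: lz; apply/negP; rewrite -ltNge.
  rewrite /left_maximal; apply/bigmax_ltP; split => // a _.
  have az : (a <= z)%N by rewrite -ltnS ltn_ord.
  rewrite ltr_pdivrMr ?ltr0n ?subn_gt0//.
  have := esum a z az; rewrite sumrB big_nat_recr//= sumr_const_nat => Hs.
  rewrite subSn// -natr1 mulrDr mulr1 mulr_natr; lra.
have tot n : e n <= \sum_(i < n) (if l <= left_maximal phi i then phi i - l else 0).
  elim: n => [|n IHn]; first by rewrite big_ord0.
  by have := step n; rewrite big_ord_recr /=; lra.
have := le_trans (e0 N) (tot N).
by rewrite -big_mkcond sumrB sumr_const subr_ge0 mulr_natr.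
Qed.

(* An interval containing [z] splits into one ending at [z] and one starting there. *)
Lemma interval_maximal (p : R) : 1 < p -> exists A : R, 0 < A /\
  forall (N : nat) (phi : nat -> R), (forall i, 0 <= phi i) ->
  exists m : nat -> R, [/\ forall i, 0 <= m i,
    forall a b z, (a <= z < b)%N -> (b <= N)%N ->
      \sum_(a <= i < b) phi i <= (b - a)%:R * m z &
    \sum_(i < N) m i `^ p <= A * \sum_(i < N) phi i `^ p].
Proof.
move=> p1; have [A [A0 HA]] := weak_type_strong p1.
have lm0 psi z : 0 <= left_maximal psi z by exact: bigmax_ge_id.
have lmle psi a z : (forall i, 0 <= psi i) -> (a <= z)%N ->
    \sum_(a <= i < z.+1) psi i <= (z.+1 - a)%:R * left_maximal psi z.
  move=> psi0 az; have az' : (a < z.+1)%N by [].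
  rewrite mulrC -ler_pdivrMr ?ltr0n ?subn_gt0//.
  exact: (le_trans _ (le_bigmax _ _ (Ordinal az'))).
exists (2 `^ p * (2 * A)); split; first by rewrite !mulr_gt0// powR_gt0.
(* [psi] is [phi] read backwards on [[0, N)], so its left maximal function is the right maximal
   function of [phi]. *)
move=> N phi phi0; pose psi i := phi (N.-1 - i)%N.
have psi0 i : 0 <= psi i by exact: phi0.
(* Both halves of [[a, b)] contain [z], so their lengths add up to [b - a + 1], at most twice
   [b - a]. *)
pose m z := 2 * Num.max (left_maximal phi z) (left_maximal psi (N.-1 - z)%N).
exists m; split.
- by move=> i; rewrite mulr_ge0// le_max lm0.
- move=> a b z /andP[az zb] bN.
  have H1 := lmle phi a z phi0 az.
  have H2 := lmle psi (N - b)%N (N.-1 - z)%N psi0 ltac:(lia).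
  have E2 : \sum_(N - b <= i < (N.-1 - z).+1) psi i = \sum_(z <= i < b) phi i.
    rewrite [RHS]big_nat_rev /=.
    have -> : (N - b = 0 + (N - b))%N by [].
    have -> : (z = 0 + z)%N by [].
    rewrite !big_addn; apply: congr_big_nat => //; first by lia.
    by move=> i /andP[_ ib]; rewrite /psi; congr phi; lia.
  rewrite E2 in H2.
  have H3 : \sum_(a <= i < b) phi i <=
      \sum_(a <= i < z.+1) phi i + \sum_(z <= i < b) phi i.
    rewrite (big_cat_nat az (ltnW zb)) /= (big_nat_recr _ _ _ az) /=.
    by have := phi0 z; lra.
  apply: (le_trans H3); apply: (le_trans (lerD H1 H2)).
  rewrite /m mulrA; set mm := Num.max _ _.
  have mm0 : 0 <= mm by rewrite le_max lm0.
  have m1 : left_maximal phi z <= mm by rewrite le_max lexx.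
  have m2 : left_maximal psi (N.-1 - z)%N <= mm by rewrite le_max lexx orbT.
  have h1 := ler_wpM2l (ler0n R (z.+1 - a)) m1.
  have h2 := ler_wpM2l (ler0n R ((N.-1 - z).+1 - (N - b))) m2.
  apply: (le_trans (lerD h1 h2)).
  rewrite -mulrDl ler_wpM2r// -natrD -natrM ler_nat; lia.
- have HL := HA 'I_N (fun i => left_maximal phi i) (fun i => phi i)
    (fun i => lm0 _ _) (fun i => phi0 _) (fun l => @left_maximal_weak phi N l phi0).
  have HR := HA 'I_N (fun i => left_maximal psi i) (fun i => psi i)
    (fun i => lm0 _ _) (fun i => psi0 _) (fun l => @left_maximal_weak psi N l psi0).
  have rev (F : nat -> R) : \sum_(i < N) F (N.-1 - i)%N = \sum_(i < N) F i.
    rewrite [RHS](reindex_inj rev_ord_inj) /=; apply: eq_bigr => i _.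
    by congr F; have := ltn_ord i; lia.
  rewrite (rev (fun i => phi i `^ p)) in HR.
  rewrite -(rev (fun i => left_maximal psi i `^ p)) in HR.
  have pp : \sum_(i < N) m i `^ p <= 2 `^ p *
     (\sum_(i < N) left_maximal phi i `^ p +
      \sum_(i < N) left_maximal psi (N.-1 - i)%N `^ p).
    rewrite -big_split /= mulr_sumr; apply: ler_sum => i _.
    rewrite /m powRM ?le_max ?lm0// ler_wpM2l ?powR_ge0//.
    set x := left_maximal phi i; set y := left_maximal psi _.
    by have := powR_ge0 x p; have := powR_ge0 y p; case: (leP x y) => _; lra.
  apply: (le_trans pp); rewrite -mulrA ler_wpM2l ?powR_ge0//; lra.
Qed.

End one_sided_maximal.

(** * The strong maximal function on a grid *)

Section grid.
Context {R : realType} {d N : nat}.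
Local Open Scope ring_scope.
Local Notation X := {ffun 'I_d -> 'I_N.+1}.

Definition dbox (a b : 'I_d -> nat) : {set X} :=
  [set x : X | [forall i, a i <= x i < b i]%N].

Lemma dboxP (a b : 'I_d -> nat) (x : X) :
  reflect (forall i, a i <= x i < b i)%N (x \in dbox a b).
Proof. by rewrite inE; exact: forallP. Qed.

Lemma card_dbox (a b : 'I_d -> nat) : (forall i, b i <= N.+1)%N ->
  #|dbox a b| = (\prod_i (b i - a i))%N.
Proof.
move=> bN; have -> : #|dbox a b| = #|family (fun i => [pred z : 'I_N.+1 | a i <= z < b i]%N)|.
  by apply: eq_card => x; rewrite inE unfold_in.
rewrite card_family foldrE big_map -big_enum /=.
apply: eq_bigr => i _.
rewrite -sum1_card -[RHS]muln1 -sum_nat_const_nat.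
rewrite (big_nat_widen _ _ N.+1)//= (big_nat_widenl _ 0)//= big_mkord.
by apply: eq_bigl => z; rewrite unfold_in andbC.
Qed.

Definition upd (T : Type) (x : 'I_d -> T) (k : 'I_d) (z : T) : 'I_d -> T :=
  fun i => if i == k then z else x i.

Definition fupd (x : X) (k : 'I_d) (z : 'I_N.+1) : X := [ffun i => upd x k z i].

(** Swapping [x k] with [z] is an involution of the pairs [(x, z)]; after it the summand no longer
    involves [z]. *)
Lemma sum_fupd (F : X -> R) (k : 'I_d) :
  \sum_x \sum_z F (fupd x k z) = N.+1%:R * \sum_x F x.
Proof.
rewrite pair_big /=; pose h (q : X * 'I_N.+1) := (fupd q.1 k q.2, q.1 k).
have hK : involutive h.
  move=> [x z]; rewrite /h /=; congr pair; last by rewrite ffunE /upd eqxx.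
  by apply/ffunP => i; rewrite ffunE /upd; case: eqP => [->|] //; rewrite ffunE /upd; case: eqP.
rewrite (reindex_inj (inv_inj hK)) /=.
rewrite (eq_bigr (fun q => F q.1)) => [|q _]; last first.
  congr F; apply/ffunP => i; rewrite ffunE /upd.
  by case: eqP => [->|] //; rewrite ffunE /upd; case: eqP.
rewrite -(pair_big xpredT xpredT (fun x (_ : 'I_N.+1) => F x)) /= mulr_sumr.
by apply: eq_bigr => x _; rewrite sumr_const card_ord mulr_natl.
Qed.

(** The one-dimensional bound is iterated, one coordinate at a time: after [k] steps the boxes are
    arbitrary in the first [k] directions and have side 1 in the others. *)
Lemma strong_maximal_upto (p A : R) :
  (forall (n : nat) (phi : nat -> R), (forall i, 0 <= phi i) ->
    exists m : nat -> R, [/\ forall i, 0 <= m i,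
    forall a b z, (a <= z < b)%N -> (b <= n)%N ->
      \sum_(a <= i < b) phi i <= (b - a)%:R * m z &
    \sum_(i < n) m i `^ p <= A * \sum_(i < n) phi i `^ p]) -> 0 < A ->
  forall (g : X -> R), (forall x, 0 <= g x) ->
  forall k, (k <= d)%N ->
  exists m : X -> R, [/\ forall x, 0 <= m x,
    forall a b x, x \in dbox a b -> (forall i, b i <= N.+1)%N ->
      (forall i : 'I_d, (k <= i)%N -> a i = x i /\ b i = (x i).+1) ->
      \sum_(y in dbox a b) g y <= #|dbox a b|%:R * m x &
    \sum_x m x `^ p <= A ^+ k * \sum_x g x `^ p].
Proof.
move=> H A0 g g0; elim=> [_|k IHk kd].
  exists g; split => //; last by rewrite expr0 mul1r.
  move=> a b x xab bN abx.
  have -> : dbox a b = [set x]%SET.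
    apply/finset.setP => y; rewrite finset.in_set1; apply/dboxP/eqP => [yab|-> i].
      by apply/ffunP => i; apply/val_inj; have := yab i; have [-> ->] := abx i isT => /=; lia.
    by have [-> ->] := abx i isT; rewrite leqnn ltnSn.
  by rewrite big_set1 cards1 mul1r.
have [m [m0 mle mp]] := IHk (ltnW kd).
(* The maximal function is chosen as a function of the sequence, so that all points of a line in
   direction [kk] share the same one. *)
have [Mx HMx] := choice (fun phi : {phi : nat -> R | forall i, 0 <= phi i} =>
  H N.+1 (sval phi) (svalP phi)).
pose kk := Ordinal kd.
have line0 x : forall i, 0 <= m (fupd x kk (inord i)) by [].
pose line x : {phi : nat -> R | forall i, 0 <= phi i} := exist _ _ (line0 x).
have lineE x z : line (fupd x kk z) = line x.
  apply: eq_exist; apply: funext => i; congr m; apply/ffunP => j.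
  by rewrite !ffunE /upd; case: eqP => // jk; rewrite ffunE /upd; case: eqP.
exists (fun x => Mx (line x) (x kk)); split.
- by move=> x; have [] := HMx (line x).
- move=> a b x xab bN abx.
  have xk := dboxP _ _ _ xab kk.
  pose a' z := upd a kk z; pose b' z := upd b kk z.+1.
  pose P := (\prod_(i | i != kk) (b i - a i))%N.
  have cQ : #|dbox a b| = ((b kk - a kk) * P)%N by rewrite card_dbox// (bigD1 kk).
  have cQz (z : 'I_N.+1) : #|dbox (a' z) (b' z)| = P.
    rewrite card_dbox => [|i]; last by rewrite /b' /upd; case: eqP.
    rewrite (bigD1 kk)// /a' /b' /upd !eqxx subSnn /= mul1n.
    by apply: eq_bigr => i /negbTE ->.
  rewrite (partition_big (fun y : X => y kk) (fun z => a kk <= z < b kk)%N) /=; last first.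
    by move=> y /dboxP/(_ kk).
  have bd (z : 'I_N.+1) : (a kk <= z < b kk)%N ->
      \sum_(y in dbox a b | y kk == z) g y <= P%:R * m (fupd x kk z).
    move=> zab; rewrite -(cQz z).
    rewrite (eq_bigl (fun y => y \in dbox (a' z) (b' z))); last first.
      move=> y; apply/andP/dboxP => [[/dboxP yab /eqP yz] i|yab].
        by rewrite /a' /b' /upd; case: eqP => [->|_]; [rewrite yz; lia|].
      have yz : y kk = z.
        by apply/val_inj; have := yab kk; rewrite /a' /b' /upd eqxx /=; lia.
      split; last exact/eqP; apply/dboxP => i; have := yab i.
      by rewrite /a' /b' /upd; case: eqP => [->|_] //; rewrite yz.
    apply: mle.
    - apply/dboxP => i; rewrite ffunE /a' /b' /upd; case: eqP => [_|_]; first by lia.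
      exact: (dboxP _ _ _ xab i).
    - by move=> i; rewrite /b' /upd; case: eqP.
    - move=> i ki; rewrite ffunE /a' /b' /upd; case: eqP => [//|ik].
      apply: abx; rewrite ltn_neqAle ki andbT; apply/eqP => kE.
      by apply: ik; apply/val_inj.
  apply: (le_trans (ler_sum _ bd)).
  rewrite -mulr_sumr cQ natrM -mulrA mulrCA ler_wpM2l//.
  have [_ /(_ (a kk) (b kk) (x kk) xk (bN kk)) Hle _] := HMx (line x).
  apply: le_trans Hle.
  rewrite (big_nat_widen _ _ N.+1)//= (big_nat_widenl _ 0)//= big_mkord.
  rewrite le_eqVlt; apply/orP; left; apply/eqP; apply: eq_big => z; first by rewrite andbC.
  by rewrite inord_val.
(* The factor [N.+1] makes room for a redundant sum along the line through each point, to which the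
   one-dimensional bound applies. *)
- rewrite -(ler_pM2l (ltr0Sn R N)) -(sum_fupd (fun x => Mx (line x) (x kk) `^ p) kk).
  apply: (@le_trans _ _ (A * \sum_x \sum_z m (fupd x kk z) `^ p)).
    rewrite mulr_sumr; apply: ler_sum => x _.
    have [_ _ Hp] := HMx (line x).
    rewrite (eq_bigr (fun z : 'I_N.+1 => Mx (line x) z `^ p)); last first.
      by move=> z _; rewrite lineE ffunE /upd eqxx.
    apply: (le_trans Hp); rewrite ler_wpM2l ?(ltW A0)//.
    by apply: ler_sum => z _; rewrite /= inord_val.
  rewrite (sum_fupd (fun x => m x `^ p)) mulrCA ler_wpM2l ?ler0n//.
  by rewrite exprS -mulrA ler_wpM2l// ltW.
Qed.

Lemma strong_maximal (p A : R) :
  (forall (n : nat) (phi : nat -> R), (forall i, 0 <= phi i) ->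
    exists m : nat -> R, [/\ forall i, 0 <= m i,
    forall a b z, (a <= z < b)%N -> (b <= n)%N ->
      \sum_(a <= i < b) phi i <= (b - a)%:R * m z &
    \sum_(i < n) m i `^ p <= A * \sum_(i < n) phi i `^ p]) -> 0 < A ->
  forall (g : X -> R), (forall x, 0 <= g x) ->
  exists m : X -> R, [/\ forall x, 0 <= m x,
    forall a b x, x \in dbox a b -> (forall i, b i <= N.+1)%N ->
      \sum_(y in dbox a b) g y <= #|dbox a b|%:R * m x &
    \sum_x m x `^ p <= A ^+ d * \sum_x g x `^ p].
Proof.
move=> H A0 g g0; have [m [m0 mle mp]] := strong_maximal_upto H A0 g0 (leqnn d).
exists m; split => // a b x xab bN; apply: mle => // i.
by rewrite leqNgt ltn_ord.
Qed.

End grid.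

(** * Greedy selection and subboxes *)

Section selection.
Context {R : realType}.
Local Open Scope ring_scope.

(* Greedy selection in decreasing order of [L]: a set is kept when less than half of it
   is covered by the sets kept before it. *)
Lemma greedy_selection (T X : finType) (B : T -> {set X}) (L : T -> nat) (E : {set T}) :
  exists S : {set T}, [/\ S \subset E,
    forall x, x \in E -> exists S' : {set T}, [/\ S' \subset S,
      (forall y, y \in S' -> L x <= L y)%N &
      (#|B x| <= 2 * #|B x :&: \bigcup_(y in S') B y|)%N] &
    forall (h : T -> R) (m : X -> R), (forall x, 0 <= h x) -> (forall x, 0 <= m x) ->
      (forall x y, x \in S -> y \in B x -> h x <= m y) ->
      \sum_(x in S) #|B x|%:R * h x <= 2 * \sum_(y in \bigcup_(x in S) B x) m y].
Proof.
have [n] := ubnP #|E|; elim: n E => // n IHn E ltn.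
have [x0 x0E|none] := pickP [pred x | x \in E]; last first.
  exists finset.set0; split; first exact: finset.sub0set.
    by move=> x xE; have := none x; rewrite /= xE.
  move=> h m h0 m0 _; by rewrite !big_set0 mulr0.
(* The set with the smallest [L] is examined last, after the selection among all the others. *)
case: (@arg_minnP _ x0 [pred x | x \in E] L x0E) => x /= xE xmin.
have [|S [SE Scov Ssum]] := IHn (E :\ x)%SET.
  by rewrite (cardsD1 x) xE in ltn.
have SE' : S \subset E by apply: fintype.subset_trans SE (finset.subsetDl _ _).
have Lx y : y \in S -> (L x <= L y)%N by move=> /(fintype.subsetP SE')/xmin.
set U := \bigcup_(y in S) B y.
have [cov|ncov] := leqP #|B x| (2 * #|B x :&: U|).
  exists S; split => // y yE; have [->|yx] := eqVneq y x; last first.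
    by apply: Scov; rewrite !inE yx yE.
  by exists S; split.
have xS : x \notin S by apply/negP => /(fintype.subsetP SE); rewrite !inE eqxx.
exists (x |: S)%SET; split.
- by rewrite finset.subUset finset.sub1set xE SE'.
- move=> y yE; have [->|yx] := eqVneq y x; last first.
    have [|S' [S'S S'L S'B]] := Scov y; first by rewrite !inE yx yE.
    by exists S'; split => //; exact: fintype.subset_trans S'S (finset.subsetUr _ _).
  exists [set x]%SET; split; first exact: finset.subsetUl.
    by move=> z; rewrite inE => /eqP ->.
  by rewrite big_set1 finset.setIid mul2n -addnn leq_addl.
- move=> h m h0 m0 hm.
  rewrite !big_setU1//= -/U.
  have -> : \sum_(y in (B x :|: U)%SET) m y = \sum_(y in B x :\: U) m y + \sum_(y in U) m y.
    rewrite (bigID (fun y => y \in U)) /= addrC; congr (_ + _).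
      by apply: eq_bigl => y; rewrite !inE; case: (y \in U); rewrite ?andbF ?orbF ?andbT.
    by apply: eq_bigl => y; rewrite !inE; case: (y \in U); rewrite ?andbF ?orbT.
  rewrite mulrDr; apply: lerD; last first.
    by apply: Ssum => // z y zS; apply: hm; rewrite inE zS orbT.
  (* Here [B x] is kept, so at least half of it lies outside [U]; this new part pays for [x]. *)
  have half : (#|B x|%:R <= 2 * #|B x :\: U|%:R :> R).
    rewrite -natrM ler_nat; have := cardsID U (B x); lia.
  apply: (@le_trans _ _ (2 * (#|B x :\: U|%:R * h x))).
    by rewrite mulrA ler_wpM2r.
  rewrite ler_pM2l// mulr_natl -sumr_const; apply: ler_sum => y.
  by rewrite inE => /andP[_]; apply: hm; rewrite !inE eqxx.
Qed.

End selection.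

Section subboxes.
Context {R : realType} {d N : nat}.
Local Open Scope ring_scope.
Local Notation X := {ffun 'I_d -> 'I_N.+1}.
Local Notation dbox := (@dbox d N).

(* Exchanging the coordinates in [G] of two points embeds [Q' * (Q :&: T)] in
   [Q * (Q' :&: T)]. *)
Lemma subbox_density (a b a' b' : 'I_d -> nat) (G : {set 'I_d}) (T : {set X}) :
  (forall i, a i <= a' i /\ b' i <= b i)%N ->
  (forall i, i \notin G -> a' i = a i /\ b' i = b i) ->
  (forall x y, x \in dbox a b -> y \in dbox a b ->
    (forall i, i \notin G -> x i = y i) -> x \in T -> y \in T) ->
  (#|dbox a' b'| * #|dbox a b :&: T| <= #|dbox a b| * #|dbox a' b' :&: T|)%N.
Proof.
move=> sub off depT.
pose mix (x y : X) : X := [ffun i => if i \in G then x i else y i].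
pose h (q : X * X) := (mix q.2 q.1, mix q.1 q.2).
have hK : involutive h.
  move=> [x y]; rewrite /h /=; congr pair; apply/ffunP => i; rewrite !ffunE;
    by case: ifP => iG; rewrite ?iG.
have subQ x : x \in dbox a' b' -> x \in dbox a b.
  by move=> /dboxP xQ; apply/dboxP => i; have := xQ i; have := sub i; lia.
rewrite -!cardsX -(card_imset _ (inv_inj hK)).
apply: subset_leq_card; apply/fintype.subsetP => q /imsetP[[y x]].
rewrite finset.in_setX finset.in_setI /= => /andP[yQ' /andP[xQ xT]] -> /=.
have yQ := subQ y yQ'.
have mQ : mix y x \in dbox a b.
  apply/dboxP => i; rewrite ffunE; case: ifP => _; [exact: (dboxP _ _ _ yQ)|exact: (dboxP _ _ _ xQ)].
rewrite finset.in_setX finset.in_setI; apply/and3P; split.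
- apply/dboxP => i; rewrite ffunE; case: ifP => _; [exact: (dboxP _ _ _ xQ)|exact: (dboxP _ _ _ yQ)].
- apply/dboxP => i; rewrite ffunE; case: ifPn => iG; first exact: (dboxP _ _ _ yQ').
  by have [-> ->] := off i iG; exact: (dboxP _ _ _ xQ).
- by apply: depT xT => // i iG; rewrite ffunE (negbTE iG).
Qed.

End subboxes.

Definition sidelengths d (c : nat) (l : 'I_d -> nat) :=
  exists alpha : 'I_c -> nat, (forall j, 0 < alpha j)%N /\ forall i, exists j, l i = alpha j.

(* Unit cubes play the role of the rectangles of complexity [0], so that the induction on
   the complexity starts with the identity operator. *)
Definition complexity d (c : nat) (l : 'I_d -> nat) :=
  if c is 0 then forall i, l i = 1%N else sidelengths c l.

Lemma complexity_gt0 d c (l : 'I_d -> nat) : complexity c l -> forall i, (0 < l i)%N.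
Proof.
by case: c => [H i|c [alpha [alpha0 H]] i]; [rewrite H|have [j ->] := H i].
Qed.

(** The sides in [G] are shortened to the length of a side outside [G], so the value [L] disappears
    from the [c.+1] admissible ones. When [G] contains every direction the box is a cube: it is left
    alone for [c > 0] and replaced by a unit cube for [c = 0]. *)
Lemma complexity_shrink d c (l : 'I_d -> nat) (L : nat) (G : {set 'I_d}) :
  complexity c.+1 l -> (forall i, l i <= L)%N -> (forall i, (i \in G) = (l i == L)) ->
  (exists i, i \in G) ->
  exists l', [/\ complexity c l', forall i, (l' i <= l i)%N & forall i, i \notin G -> l' i = l i].
Proof.
move=> cl lL lG [i0]; rewrite lG => /eqP i0L.
have l0 := complexity_gt0 cl.
have [[i1 i1G]|allG] := pselect (exists i, i \notin G); last first.
  have lE i : l i = L.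
    by apply/eqP; rewrite -lG; apply: contrapT => /negP iG; apply: allG; exists i.
  case: c cl => [|c] cl.
    exists (fun=> 1%N); split=> [i|i|i] //.
    by rewrite lG lE eqxx.
  exists (fun=> L); split=> [|i|i]; rewrite ?lE//.
  exists (fun=> L); split => [_|i]; last by exists ord0.
  by rewrite -i0L.
case: cl => alpha [alpha0 al]; have [j0 i0j] := al i0.
have lift0 i : i \notin G -> exists j, l i = alpha (lift j0 j).
  rewrite lG => iL; have [j ij] := al i; have jj0 : j0 != j.
    by apply: contraNneq iL => j0j; rewrite ij -j0j -i0j i0L.
  by have [j' j'E] := unlift_some jj0; exists j'; rewrite -j'E.
case: c alpha alpha0 al j0 i0j lift0 => [|c] alpha alpha0 al j0 i0j lift0.
  by have [[]] := lift0 i1 i1G.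
exists (fun i => if i \in G then l i1 else l i); split.
- exists (fun j => alpha (lift j0 j)); split => // i.
  by case: ifPn => [_|]; exact: lift0.
- move=> i; case: ifP => //; rewrite lG => /eqP ->; exact: lL.
- by move=> i /negbTE ->.
Qed.

(** [G] consists of all the sides of length [L], so the dilation changes one admissible value and
    creates no new one. *)
Lemma complexity_dilate d c (l : 'I_d -> nat) (L : nat) (G : {set 'I_d}) :
  complexity c.+1 l -> (forall i, (i \in G) = (l i == L)) ->
  complexity c.+1 (fun i => if i \in G then (3 * L)%N else l i).
Proof.
move=> [alpha [alpha0 al]] lG.
exists (fun j => if alpha j == L then (3 * L)%N else alpha j); split.
  by move=> j; case: eqP => [<-|//]; rewrite muln_gt0 /=.
by move=> i; have [j ij] := al i; exists j; rewrite lG ij.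
Qed.

(** * Induction on the complexity *)

Section grid_induction.
Context {R : realType} {d : nat} (p : R).
Local Open Scope ring_scope.
Hypothesis p1 : 1 < p.

Let p_gt0 : 0 < p. Proof. exact: lt_trans ltr01 p1. Qed.

Let p_ge0 : 0 <= p. Proof. exact: ltW. Qed.

Local Notation grid N := {ffun 'I_d -> 'I_N.+1}.
Local Notation cube a l := (dbox a (fun i => (a i + l i)%N)).

Lemma cubeP N (a l : 'I_d -> nat) (x : grid N) :
  reflect (forall i, a i <= x i < a i + l i)%N (x \in cube a l).
Proof. exact: dboxP. Qed.

(* The grid [0, 3M)^d contains the threefold dilations of the boxes of [M, 2M)^d. *)
Definition central (M : nat) (a l : 'I_d -> nat) :=
  forall i, (M <= a i)%N /\ (a i + l i <= 2 * M)%N.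

(** [u k] stands for M_k ... M_1 w. Inequalities replace the suprema, so that lower bounds of the
    iterates on the cells of R^d can be used as [u]. *)
Definition averages_below N (c : nat) (u : nat -> grid N -> R) :=
  forall k a l x, (k < c)%N -> sidelengths k.+1 l -> (forall i, a i + l i <= N.+1)%N ->
    x \in cube a l -> \sum_(y in cube a l) u k y <= #|(cube a l : {set grid N})|%:R * u k.+1 x.

Definition in_heavy_box N M (f : grid N -> R) (t : R) (P : ('I_d -> nat) -> Prop) (x : grid N) :=
  exists a l, [/\ central M a l, P l, x \in cube a l &
    t * #|(cube a l : {set grid N})|%:R <= \sum_(y in cube a l) f y].

(** [C] is uniform in the size of the grid. [Q] allows boxes with a prescribed set of longest sides
    to be treated separately. *)
Definition grid_weak_type (c : nat) (C : R) (Q : ('I_d -> nat) -> Prop) :=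
  forall N M (u : nat -> grid N -> R) (f : grid N -> R) (t : R) (E : {set grid N}),
  N.+1 = (3 * M)%N -> (forall k x, 0 <= u k x) -> averages_below c u ->
  (forall x, 0 <= f x) -> 0 < t ->
  (forall x, x \in E -> in_heavy_box M f t (fun l => complexity c l /\ Q l) x) ->
  t `^ p * \sum_(x in E) u 0%N x <= C * \sum_x f x `^ p * u c x.

(** A heavy unit cube containing [x] says that [t <= f x], so the bound holds term by term. *)
Lemma grid_weak_type0 : grid_weak_type 0 1 (fun=> True).
Proof.
move=> N M u f t E NM u0 _ f0 t0 HE; rewrite mul1r mulr_sumr.
rewrite big_mkcond /=; apply: ler_sum => x _.
case: ifPn => xE; last by rewrite mulr_ge0 ?powR_ge0.
apply: ler_wpM2r => //; apply: ge0_ler_powR; rewrite ?nnegrE ?(ltW t0)//.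
have [a [l [cen [l1 _] xQ]]] := HE x xE.
have -> : cube a l = [set x]%SET.
  apply/finset.setP => y; rewrite finset.in_set1; apply/cubeP/eqP => [yQ|->]; last exact/cubeP.
  apply/ffunP => i; apply/val_inj => /=; have := yQ i; have := cubeP _ _ _ xQ i.
  by rewrite (l1 i); lia.
by rewrite big_set1 cards1 mulr1.
Qed.

Lemma sum_bigcup_le (T Y : finType) (S : {set T}) (B : T -> {set Y}) (v : Y -> R) :
  (forall y, 0 <= v y) ->
  \sum_(y in \bigcup_(x in S) B x) v y <= \sum_(x in S) \sum_(y in B x) v y.
Proof.
move=> v0; under [X in _ <= X]eq_bigr do rewrite big_mkcond.
rewrite exchange_big big_mkcond /=; apply: ler_sum => y _.
case: ifPn => [/finset.bigcupP[x xS yB]|_]; last first.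
  by apply: sumr_ge0 => x _; case: ifP.
rewrite (bigD1 x)//= yB lerDl; apply: sumr_ge0 => z _; by case: ifP.
Qed.

Variable A : R.
Hypothesis maxA : forall N (g : grid N -> R), (forall x, 0 <= g x) ->
  exists m : grid N -> R, [/\ forall x, 0 <= m x,
    forall a b x, x \in dbox a b -> (forall i, b i <= N.+1)%N ->
      \sum_(y in dbox a b) g y <= #|(dbox a b : {set grid N})|%:R * m x &
    \sum_x m x `^ p <= A * \sum_x g x `^ p].

(* The averages of [u c] over the dilated boxes are bounded by [u c.+1], and moving them
   inside the averages of [f] leaves an unweighted maximal inequality. *)
Lemma dilated_boxes_bound N M c (u : nat -> grid N -> R) (f : grid N -> R) (t : R)
    (a l a' l' : grid N -> 'I_d -> nat) (S : {set grid N}) :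
  N.+1 = (3 * M)%N -> (forall k x, 0 <= u k x) -> averages_below c.+1 u ->
  (forall x, 0 <= f x) -> 0 < t ->
  (forall (h : grid N -> R) (m : grid N -> R), (forall x, 0 <= h x) -> (forall x, 0 <= m x) ->
      (forall x y, x \in S -> y \in cube (a x) (l x) -> h x <= m y) ->
      \sum_(x in S) #|(cube (a x) (l x) : {set grid N})|%:R * h x <= 2 * \sum_x m x) ->
  (forall x, x \in S -> [/\ central M (a x) (l x), complexity c.+1 (l' x),
     t * #|(cube (a x) (l x) : {set grid N})|%:R <= \sum_(y in cube (a x) (l x)) f y &
     forall i, [/\ a' x i <= a x i, 0 < l x i, a x i + l x i <= a' x i + l' x i,
       l' x i <= 3 * l x i & a' x i + l' x i <= N.+1]%N]) ->
  t `^ p * \sum_(y in \bigcup_(x in S) cube (a' x) (l' x)) u c y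
  <= 2 * 3 ^+ d * A * \sum_x f x `^ p * u c.+1 x.
Proof.
move=> NM u0 uavg f0 t0 Hsel HS.
pose B x : {set grid N} := cube (a x) (l x); pose B' x : {set grid N} := cube (a' x) (l' x).
have p0 := p_gt0.
pose g x := f x * u c.+1 x `^ p^-1.
have g0 x : 0 <= g x by rewrite mulr_ge0 ?powR_ge0.
have [m [m0 mavg mp]] := maxA g0.
pose h x := (\sum_(y in B x) g y / #|B x|%:R) `^ p.
have sub x : x \in S -> B x \subset B' x.
  move=> xS; have [_ _ _ Hi] := HS x xS.
  apply/fintype.subsetP => y /cubeP yB; apply/cubeP => i.
  by have := yB i; have [] := Hi i; clear; lia.
have card0 x : x \in S -> (0 < #|B x|)%N.
  move=> xS; have [cen _ _ Hi] := HS x xS.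
  rewrite card_dbox => [|i]; last by have := cen i; move: NM; clear; lia.
  by apply: prodn_gt0 => i; have [_ li _ _ _] := Hi i; rewrite addKn.
have card3 x : x \in S -> (#|B' x| <= 3 ^ d * #|B x|)%N.
  move=> xS; have [cen _ _ Hi] := HS x xS.
  rewrite !card_dbox => [|i|i]; last 2 first.
  - by have := cen i; move: NM; clear; lia.
  - by have [] := Hi i.
  rewrite -[X in (3 ^ X)%N]card_ord -prod_nat_const -big_split /=.
  by apply: leq_prod => i _; rewrite !addKn; have [] := Hi i.
have hm x y : x \in S -> y \in B x -> h x <= m y `^ p.
  move=> xS yB; have [cen _ _ _] := HS x xS.
  apply: ge0_ler_powR; rewrite ?nnegrE//.
  - by rewrite -mulr_suml divr_ge0// sumr_ge0.
  - rewrite -mulr_suml ler_pdivrMr ?ltr0n ?card0// mulrC; apply: mavg => // i.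
    by have := cen i; move: NM; clear; lia.
have Hh := Hsel h (fun x => m x `^ p) (fun x => powR_ge0 _ _) (fun x => powR_ge0 _ _) hm.
have each x : x \in S -> t `^ p * \sum_(y in B' x) u c y <= 3 ^+ d * (#|B x|%:R * h x).
  move=> xS; have [cen cl tf Hi] := HS x xS.
  have cB : 0 < #|B x|%:R :> R by rewrite ltr0n card0.
  have cB' : 0 < #|B' x|%:R :> R.
    by rewrite ltr0n (leq_trans (card0 _ xS))// subset_leq_card// sub.
  pose v := (\sum_(y in B' x) u c y) / #|B' x|%:R.
  have v0 : 0 <= v by rewrite divr_ge0// sumr_ge0.
  have vu y : y \in B' x -> v <= u c.+1 y.
    move=> yB; rewrite /v ler_pdivrMr// mulrC; apply: uavg => //.
    by move=> i; have [] := Hi i.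
  have tv : t `^ p * v <= h x.
    have -> : t `^ p * v = (t * v `^ p^-1) `^ p.
      by rewrite powRM ?powR_ge0 ?(ltW t0)// -powRrM mulVf ?powRr1// gt_eqF.
    apply: ge0_ler_powR; rewrite ?nnegrE ?mulr_ge0 ?powR_ge0 ?(ltW t0)//.
      by rewrite -mulr_suml divr_ge0// sumr_ge0.
    rewrite -mulr_suml ler_pdivlMr// mulrAC.
    apply: (le_trans (ler_wpM2r (powR_ge0 _ _) tf)).
    rewrite mulr_suml; apply: ler_sum => y yB; rewrite /g ler_wpM2l//.
    apply: ge0_ler_powR; rewrite ?nnegrE ?invr_ge0 ?(ltW p0)//.
    by apply: vu; apply: (fintype.subsetP (sub x xS)).
  have -> : \sum_(y in B' x) u c y = v * #|B' x|%:R by rewrite /v divfK// gt_eqF.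
  rewrite mulrA; apply: (le_trans (ler_wpM2r (ltW cB') tv)).
  rewrite mulrC mulrA ler_wpM2r ?powR_ge0//.
  by rewrite -natrX -natrM ler_nat card3.
have st : \sum_(y in \bigcup_(x in S) B' x) u c y <= \sum_(x in S) \sum_(y in B' x) u c y.
  by apply: sum_bigcup_le => y; exact: u0.
apply: (le_trans (ler_wpM2l (powR_ge0 _ _) st)).
have {}each : t `^ p * (\sum_(x in S) \sum_(y in B' x) u c y) <=
    3 ^+ d * \sum_(x in S) #|B x|%:R * h x.
  by rewrite !mulr_sumr; apply: ler_sum.
apply: (le_trans each).
have tot := le_trans Hh (ler_wpM2l (ler0n R 2) mp).
have -> : \sum_x f x `^ p * u c.+1 x = \sum_x g x `^ p.
  apply: eq_bigr => x _; rewrite /g powRM ?powR_ge0// -powRrM mulVf ?powRr1//.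
  by rewrite gt_eqF.
apply: (le_trans (ler_wpM2l _ tot)); first by rewrite exprn_ge0.
by rewrite le_eqVlt; apply/orP; left; apply/eqP; ring.
Qed.

Definition longest_sides (G : {set 'I_d}) (l : 'I_d -> nat) :=
  exists L, (forall i, l i <= L)%N /\ (forall i, (i \in G) = (l i == L)).

Lemma grid_weak_type_longest c (C : R) (G : {set 'I_d}) : 0 <= C -> (exists i, i \in G) ->
  grid_weak_type c C (fun=> True) ->
  grid_weak_type c.+1 (C * 2 `^ p * (2 * 3 ^+ d * A)) (longest_sides G).
Proof.
move=> C0 G0 IH N M u f t E NM u0 uavg f0 t0 HE.
have /choice[al Hal] : forall x, exists al : ('I_d -> nat) * ('I_d -> nat) * nat, x \in E ->
    [/\ central M al.1.1 al.1.2, complexity c.+1 al.1.2, x \in cube al.1.1 al.1.2,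
        t * #|(cube al.1.1 al.1.2 : {set grid N})|%:R <= \sum_(y in cube al.1.1 al.1.2) f y &
        (forall i, al.1.2 i <= al.2)%N /\ (forall i, (i \in G) = (al.1.2 i == al.2))].
  move=> x; have [xE|xE] := boolP (x \in E); last by exists (fun=> 0, fun=> 0, 0)%N.
  by have [a [l [cen [cl [L LG]] xQ tf]]] := HE x xE; exists (a, l, L).
pose a x := (al x).1.1; pose l x := (al x).1.2; pose L x := (al x).2.
(* In the directions of [G] the box is extended by [L x] on both sides. For [x] in [E] the
   subtraction is not truncated: a central box has sides at most [M] and [M <= a x i]. *)
pose a' x i := if i \in G then (a x i - L x)%N else a x i.
pose l' x i := if i \in G then (3 * L x)%N else l x i.
pose B x : {set grid N} := cube (a x) (l x); pose B' x : {set grid N} := cube (a' x) (l' x).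
have [S [SE Scov Ssum]] := @greedy_selection R _ _ B L E.
pose T := \bigcup_(x in S) B' x.
have sub x : x \in E -> B x \subset B' x.
  move=> xE; have [cen _ _ _ [lL lG]] := Hal x xE.
  apply/fintype.subsetP => y /cubeP yB; apply/cubeP => i; have := yB i; have := cen i.
  rewrite /a' /l'; case: ifP => // iG; have := lL i; have := lG i; rewrite iG => /esym/eqP.
  by rewrite -/(a x) -/(l x) -/(L x); clear; lia.
have bound := @dilated_boxes_bound N M c u f t a l a' l' S NM u0 uavg f0 t0.
have /bound{bound}bound : forall (h m : grid N -> R), (forall x, 0 <= h x) -> (forall x, 0 <= m x) ->
    (forall x y, x \in S -> y \in cube (a x) (l x) -> h x <= m y) ->
    \sum_(x in S) #|(cube (a x) (l x) : {set grid N})|%:R * h x <= 2 * \sum_x m x.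
  move=> h m h0 m0 hm; apply: (le_trans (Ssum h m h0 m0 hm)); rewrite ler_pM2l//.
  by rewrite big_mkcond; apply: ler_sum => x _; case: ifP.
have {}bound : t `^ p * \sum_(y in T) u c y
    <= 2 * 3 ^+ d * A * \sum_x f x `^ p * u c.+1 x.
  apply: bound => x xS; have xE := fintype.subsetP SE x xS.
  have [cen cl _ tf [lL lG]] := Hal x xE; split => //.
    exact: complexity_dilate lG.
  move=> i; have := cen i; have := lL i; have := lG i; have := complexity_gt0 cl i.
  rewrite /a' /l' -/(a x) -/(l x) -/(L x); case: ifP => _.
    move=> l0 /esym/eqP lE lL' cE; move: l0 lE lL' cE NM.
    by clear=> l0 lE lL' cE NM; split; move: l0 lE lL' cE NM; clear; lia.
  move=> l0 _ lL' cE; move: l0 lL' cE NM.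
  by clear=> l0 lL' cE NM; split; move: l0 lL' cE NM; clear; lia.
have covered x : x \in E ->
    in_heavy_box M (fun y => (y \in T)%:R) (2^-1) (fun l => complexity c l /\ True) x.
  move=> xE; have [cen cl xQ _ [lL lG]] := Hal x xE; rewrite -/(a x) -/(l x) in cen cl xQ.
  have [k [ck kl kG]] := complexity_shrink cl lL lG G0.
  (* The shortened box starts at [x] in the directions of [G], or is pushed back just enough to fit
     into [B x]. *)
  pose b i := if i \in G then minn (x i) (a x i + l x i - k i) else a x i.
  have bsub i : (a x i <= b i /\ b i + k i <= a x i + l x i)%N.
    rewrite /b; have := kl i; have := cubeP _ _ _ xQ i.
    by case: ifPn => [_|/kG]; move: (nat_of_ord (x i)) (a x i) (l x i) (k i); clear; lia.
  have xb : x \in cube b k.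
    apply/cubeP => i; rewrite /b; have := kl i; have := cubeP _ _ _ xQ i.
    have := complexity_gt0 ck i.
    by case: ifPn => [_|/kG]; move: (nat_of_ord (x i)) (a x i) (l x i) (k i); clear; lia.
  exists b, k; split => //.
    by move=> i; have := cen i; have := bsub i; clear; lia.
  have -> : \sum_(y in cube b k) (y \in T)%:R = #|cube b k :&: T|%:R :> R.
    rewrite -sumr_const (eq_bigl _ _ (fun y => finset.in_setI y _ _)) big_mkcondr.
    by apply: eq_bigr => y _; case: (y \in T).
  have [S' [S'S S'L S'B]] := Scov x xE.
  (* Only the kept boxes that meet [B x] matter, and for these the dilations have a simple shape
     inside [B x]. *)
  pose S2 := [set y in S' | B y :&: B x != finset.set0]%SET.
  pose T2 := \bigcup_(y in S2) B' y.
  have T2T : T2 \subset T.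
    apply/bigcupsP => y; rewrite inE => /andP[yS' _].
    exact: (finset.bigcup_sup y (fintype.subsetP S'S y yS')).
  have half : (#|B x| <= 2 * #|B x :&: T2|)%N.
    apply: (leq_trans S'B); rewrite leq_mul2l /=; apply: subset_leq_card.
    apply/fintype.subsetP => z; rewrite !finset.in_setI => /andP[zB /finset.bigcupP[y yS' zy]].
    rewrite zB /=; apply/finset.bigcupP; exists y.
      rewrite inE yS' /=; apply/set0Pn; exists z; by rewrite finset.in_setI zy.
    apply: (fintype.subsetP (sub y _)) zy; apply: (fintype.subsetP SE).
    exact: (fintype.subsetP S'S).
  have dens := @subbox_density d N (a x) (fun i => a x i + l x i)%N b (fun i => b i + k i)%N G T2.
  have {}dens := dens bsub.
  have /dens{dens} : forall i, i \notin G -> b i = a x i /\ (b i + k i)%N = (a x i + l x i)%N.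
    by move=> i iG; rewrite /b (negbTE iG) (kG i iG).
  (* A box of [S2] meets [B x] and its longest side is at least [L x], so in the directions of [G]
     its dilation covers [B x]. Moving a point of [B x] in these directions does not leave the
     dilation. *)
  have depT : forall z w : grid N, z \in cube (a x) (l x) -> w \in cube (a x) (l x) ->
      (forall i, i \notin G -> z i = w i) -> z \in T2 -> w \in T2.
    move=> z w zQ wQ zw /finset.bigcupP[y yS2 zy]; apply/finset.bigcupP; exists y => //.
    move: yS2; rewrite inE => /andP[yS' /set0Pn[q]]; rewrite finset.in_setI => /andP[qy qx].
    have yE : y \in E by apply: (fintype.subsetP SE); apply: (fintype.subsetP S'S).
    have [ceny _ _ _ [lLy lGy]] := Hal y yE.
    apply/cubeP => i; have := cubeP _ _ _ zy i; rewrite /a' /l'.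
    case: ifPn => iG; last by rewrite zw.
    have := cubeP _ _ _ qy i; have := cubeP _ _ _ qx i; have := cubeP _ _ _ wQ i.
    have := lGy i; have := lG i; rewrite iG => /esym/eqP + /esym/eqP.
    have := S'L y yS'; have := ceny i.
    by rewrite -/(a x) -/(l x) -/(L x) -/(a y) -/(l y) -/(L y); clear; lia.
  move=> /(_ depT); rewrite -/(B x).
  have sub2 : (#|cube b k :&: T2| <= #|cube b k :&: T|)%N.
    by apply: subset_leq_card; exact: finset.setIS.
  have B0 : (0 < #|B x|)%N by apply/card_gt0P; exists x.
  move=> dens; rewrite mulrC ler_pdivrMr// -natrM ler_nat.
  rewrite -(leq_pmul2l B0); apply: (@leq_trans (2 * (#|B x| * #|cube b k :&: T2|))).
    apply: (@leq_trans (2 * (#|cube b k| * #|B x :&: T2|))); last by rewrite leq_mul2l /=; exact: dens.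
    by rewrite [X in (_ <= X)%N]mulnCA [X in (X <= _)%N]mulnC leq_mul2l half orbT.
  by rewrite mulnCA leq_mul2l mulnC leq_mul2r sub2 !orbT.
have uavg' : averages_below c u by move=> k b j x kc; apply: uavg; exact: ltnW.
have := @IH N M u (fun y => (y \in T)%:R) 2^-1 E NM u0 uavg'
  (fun=> ler0n _ _) ltac:(lra) covered.
have -> : \sum_x (x \in T)%:R `^ p * u c x = \sum_(x in T) u c x.
  rewrite [RHS]big_mkcond; apply: eq_bigr => x _; case: ifP => _.
    by rewrite powR1 mul1r.
  by rewrite powR0 ?mul0r// gt_eqF.
have -> : 2^-1 `^ p = (2 `^ p)^-1 :> R.
  by rewrite -powR_inv1// -powRrM mulN1r powRN.
have two0 : 0 < 2 `^ p :> R by exact: powR_gt0.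
rewrite mulrC ler_pdivrMr// => H1.
apply: (le_trans (ler_wpM2l (powR_ge0 _ _) H1)).
have := ler_wpM2l (mulr_ge0 C0 (ltW two0)) bound.
set s1 := \sum_(y in T) _; set s2 := \sum_x _ => H2.
rewrite (_ : t `^ p * (C * s1 * 2 `^ p) = C * 2 `^ p * (t `^ p * s1)); last by ring.
by apply: (le_trans H2); rewrite !mulrA.
Qed.

End grid_induction.

(** The points of [E] are sorted by the set of longest sides of a heavy box containing them,
    nonempty as [0 < d]; each step of the induction multiplies the constant by the number of subsets
    of the directions. *)
Lemma grid_fefferman_stein (R : realType) (d c : nat) (p : R) : (0 < d)%N -> (1 < p)%R ->
  exists C : R, (0 <= C)%R /\ @grid_weak_type R d p c C (fun=> True).
Proof.
move=> d0 p1; have [A1 [A10 HA1]] := interval_maximal p1.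
have HA := fun N (g : {ffun 'I_d -> 'I_N.+1} -> R) => strong_maximal HA1 A10 (g := g).
elim: c => [|c [C [C0 IH]]]; first by exists 1%R; split => //; exact: grid_weak_type0.
pose C1 := (C * 2 `^ p * (2 * 3 ^+ d * A1 ^+ d))%R.
have C10 : (0 <= C1)%R.
  by rewrite !mulr_ge0 ?powR_ge0 ?exprn_ge0// ltW.
have step G := @grid_weak_type_longest R d p p1 _ HA c C G C0.
exists (#|{set 'I_d}|%:R * C1)%R; split; first by rewrite mulr_ge0.
move=> N M u f t E NM u0 uavg f0 t0 HE.
have /choice[G HG] : forall x, exists G : {set 'I_d}, x \in E ->
    (exists i, i \in G) /\
    in_heavy_box M f t (fun l => complexity c.+1 l /\ longest_sides G l) x.
  move=> x; have [xE|xE] := boolP (x \in E); last by exists finset.set0.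
  have [a [l [cen [cl _] xQ tf]]] := HE x xE.
  case: (@arg_maxnP _ (Ordinal d0) xpredT l isT) => i0 _ imax.
  exists [set i | l i == l i0]%SET => _; split; first by exists i0; rewrite inE.
  exists a, l; split => //; split => //.
  by exists (l i0); split => i; [exact: imax|rewrite inE].
rewrite (partition_big G xpredT)//= mulr_sumr -mulrA mulr_natl -sumr_const.
apply: ler_sum => H _; have [H0|H0] := pselect (exists i, i \in H); last first.
  rewrite big_pred0 ?mulr0 => [|x].
    by rewrite mulr_ge0// sumr_ge0// => x _; rewrite mulr_ge0// powR_ge0.
  by apply/negP => /andP[/HG[i _] /eqP GH]; apply: H0; rewrite -GH.
have := step H H0 IH N M u f t [set x in E | G x == H]%SET NM u0 uavg f0 t0.
rewrite (eq_bigl (fun x => (x \in E) && (G x == H))) => [|x]; last by rewrite inE.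
apply=> x; rewrite inE => /andP[xE /eqP <-].
by have [] := HG x xE.
Qed.

Local Open Scope classical_set_scope.
Local Open Scope ring_scope.
Local Open Scope ereal_scope.

(** * Lebesgue measure of boxes and integrals over disjoint pieces *)

Section measure_prelim.
Context {R : realType}.

(** The integral is a supremum over the simple functions below the integrand, so monotonicity holds
    for arbitrary nonnegative functions, in particular for the iterated maximal functions. *)
Lemma ge0_integral_mono d (T : measurableType d) (mu : {measure set T -> \bar R})
    (D : set T) (f g : T -> \bar R) :
  (forall x, D x -> 0 <= f x) -> (forall x, D x -> f x <= g x) ->
  \int[mu]_(x in D) f x <= \int[mu]_(x in D) g x.
Proof.
move=> f0 fg; have g0 x : D x -> 0 <= g x by move=> Dx; exact: le_trans (f0 x Dx) (fg x Dx).
rewrite !ge0_integralE//; apply: le_ereal_sup => _ [h hf <-]; exists h => // x.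
apply: (le_trans (hf x)); rewrite !patchE; case: ifPn => // xD.
by apply: fg; rewrite inE in xD.
Qed.

(** The same set as [box], in the Borel space where the measure is built as a product. *)
Definition tuple_box n (a b : 'I_n -> R) (l r : 'I_n -> bool) :
    set (n.-tuple (measurableTypeR R)) :=
  [set x | forall i, tnth x i \in Interval (BSide (l i) (a i)) (BSide (r i) (b i))].

Lemma measurable_tuple_box n (a b : 'I_n -> R) (l r : 'I_n -> bool) :
  measurable (tuple_box a b l r).
Proof.
have -> : tuple_box a b l r = \bigcap_(i in [set: 'I_n])
    ((fun x : n.-tuple (measurableTypeR R) => tnth x i) @^-1`
     [set` Interval (BSide (l i) (a i)) (BSide (r i) (b i))]).
  by apply/seteqP; split => [x xab i _|x xab i]; [exact: xab|exact: xab i I].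
apply: fin_bigcap_measurable => [|i _]; first exact: finite_finset.
rewrite -[X in measurable X]setTI; exact: measurable_tnth.
Qed.

Lemma borel_lebesgue_box n (a b : 'I_n -> R) (l r : 'I_n -> bool) :
  (forall i, a i < b i)%R ->
  borel_lebesgue R n (tuple_box a b l r) = (\prod_i (b i - a i))%:E.
Proof.
elim: n a b l r => [|n IHn] a b l r ab.
  rewrite big_ord0 /= diracE mem_set//; by case.
rewrite big_ord_recl EFinM.
rewrite -(IHn _ _ (fun i => l (lift ord0 i)) (fun i => r (lift ord0 i)))//.
have -> : (b ord0 - a ord0)%:E = lebesgue_measure
    [set` Interval (BSide (l ord0) (a ord0)) (BSide (r ord0) (b ord0))].
  by rewrite lebesgue_measure_itv/= lte_fin ab EFinB.
rewrite -product_measure1E//; last exact: measurable_tuple_box.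
rewrite /= /product_step /pushforward; congr (_ _).
apply/seteqP; split => [[x y] xy|[x y] [xi yi] i] /=.
  split; first exact: (xy ord0).
  by move=> i; have := xy (lift ord0 i); rewrite tnthS.
have [j ->|->] := unliftP ord0 i; last exact: xi.
by rewrite tnthS; exact: yi.
Qed.

Local Notation Rd := (Rd R).
Local Notation leb := (leb R).

Lemma measurable_box d (a b : 'I_d -> R) (l r : 'I_d -> bool) :
  measurable (box a b l r : set (Rd d)).
Proof.
exact: (@caratheodory_measurable_mu_ext _ R _ (borel_lebesgue R d) _
  (measurable_tuple_box a b l r)).
Qed.

Lemma leb_box d (a b : 'I_d -> R) (l r : 'I_d -> bool) : (forall i, a i < b i)%R ->
  leb d (box a b l r) = (\prod_i (b i - a i))%:E.
Proof.
move=> ab; rewrite -(borel_lebesgue_box l r ab).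
exact: (@measurable_mu_extE _ _ _ (borel_lebesgue R d) _ (measurable_tuple_box a b l r)).
Qed.

Lemma compactRd_box d (a b : 'I_d -> R) :
  compactRd (box a b (fun=> true) (fun=> false) : set (Rd d)).
Proof.
rewrite /compactRd (_ : image _ _ =
  [set v : 'rV[R]_d | forall i, `[a i, b i]%classic (v ord0 i)]).
  by apply: (@rV_compact R d (fun i => `[a i, b i]%classic)) => i; exact: segment_compact.
apply/seteqP; split => [_ [x xab <-] i|v vab]; first by rewrite mxE; exact: xab.
exists [tuple v ord0 i | i < d].
  by move=> i; rewrite tnth_mktuple; exact: vab.
by apply/rowP => i; rewrite mxE tnth_mktuple.
Qed.

End measure_prelim.

Section integrals_over_pieces.
Context {R : realType} {dsp : measure_display} {T : measurableType dsp}.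
Variables (mu : {measure set T -> \bar R}) (I : finType) (F : I -> set T).
Hypothesis mF : forall i, measurable (F i).

Lemma sum_integral_pieces (A : {set I}) (c : I -> R) (h : T -> \bar R) :
  measurable_fun [set: T] h -> (forall x, 0 <= h x) -> (forall i, (0 <= c i)%R) ->
  \sum_(i in A) (c i)%:E * \int[mu]_(x in F i) h x =
  \int[mu]_x \sum_(i in A) (c i)%:E * (h \_ (F i)) x.
Proof.
move=> mh h0 c0; rewrite -[LHS]big_enum /=.
have mhF i : measurable_fun [set: T] (h \_ (F i)).
  by apply: (measurable_restrictT h (mF i)).1; exact: measurable_funTS.
have hF0 i x : 0 <= (h \_ (F i)) x by rewrite patchE; case: ifP.
under [X in _ = \int[mu]_x X x]eq_fun do rewrite -big_enum /=.
rewrite ge0_integral_sum//=.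
- apply: eq_bigr => i _; rewrite integral_mkcond ge0_integralZl_EFin//.
- by move=> i; apply: measurable_funeM.
- by move=> i x _; rewrite mule_ge0// lee_fin.
Qed.

Lemma integral_le_sum_pieces (A : {set I}) (D : set T) (h : T -> \bar R) :
  measurable_fun [set: T] h -> (forall x, 0 <= h x) ->
  (forall x, D x -> exists2 i, i \in A & F i x) ->
  \int[mu]_(x in D) h x <= \sum_(i in A) \int[mu]_(x in F i) h x.
Proof.
move=> mh h0 DF.
have := @sum_integral_pieces A (fun=> 1%R) h mh h0 (fun=> ler01).
under eq_bigr do rewrite mul1e; move=> ->.
under [X in _ <= \int[mu]_x X x]eq_fun do under eq_bigr do rewrite mul1e.
have hF0 i x : 0 <= (h \_ (F i)) x by rewrite patchE; case: ifP.
rewrite integral_mkcond; apply: ge0_integral_mono => x _.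
  by rewrite patchE; case: ifP.
rewrite patchE; case: ifPn => [|_]; last by exact: sume_ge0.
rewrite inE => /DF[i iA Fix]; rewrite (bigD1 i)//= patchE mem_set//.
by rewrite leeDl// sume_ge0.
Qed.

Lemma sum_pieces_le_integral (A : {set I}) (D : set T) (c : I -> R) (h G : T -> \bar R) :
  (forall i j x, F i x -> F j x -> i = j) ->
  measurable_fun [set: T] h -> (forall x, 0 <= h x) -> (forall i, (0 <= c i)%R) ->
  (forall x, D x -> 0 <= G x) -> (forall i, i \in A -> F i `<=` D) ->
  (forall i x, i \in A -> F i x -> (c i)%:E * h x <= G x) ->
  \sum_(i in A) (c i)%:E * \int[mu]_(x in F i) h x <= \int[mu]_(x in D) G x.
Proof.
move=> dF mh h0 c0 G0 FD chG; rewrite sum_integral_pieces//.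
have hF0 i x : 0 <= (h \_ (F i)) x by rewrite patchE; case: ifP.
rewrite [leRHS]integral_mkcond; apply: ge0_integral_mono => x _.
  by apply: sume_ge0 => i _; rewrite mule_ge0// lee_fin.
have [[i iA Fix]|none] := pselect (exists2 i, i \in A & F i x).
  rewrite (bigD1 i)//= big1 ?adde0 => [|j /andP[jA ji]]; last first.
    rewrite patchE memNset ?mule0// => Fjx.
    by rewrite (dF _ _ _ Fix Fjx) eqxx in ji.
  by rewrite !patchE !mem_set//; [exact: chG|exact: FD Fix].
rewrite big1 => [|i iA]; last first.
  by rewrite patchE memNset ?mule0// => Fix; apply: none; exists i.
by rewrite patchE; case: ifPn => //; rewrite inE; exact: G0.
Qed.

End integrals_over_pieces.

(** Jensen's inequality for the mean [a] of [g] over [D]: the tangent to the [p]-th power at [a],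
    which is Young's inequality, is integrated over [D]. *)
Lemma powR_integral_le {R : realType} {dsp : measure_display} {T : measurableType dsp}
    (mu : {measure set T -> \bar R}) (D : set T) (p m a : R) (g : T -> R) :
  (1 < p)%R -> measurable D -> mu D = m%:E -> measurable_fun [set: T] g ->
  (forall x, 0 <= g x)%R -> (0 <= a)%R -> \int[mu]_(x in D) (g x)%:E = (a * m)%:E ->
  (a `^ p * m)%:E <= \int[mu]_(x in D) (g x `^ p)%:E.
Proof.
move=> p1 mD muD mg g0 a0 Dg.
have p0 : (0 < p)%R by lra.
have mgD : measurable_fun D (EFin \o g) by apply: measurable_funTS; exact/measurable_EFinP.
have mgp : measurable_fun D (fun x => (g x `^ p)%:E).
  apply: measurable_funTS; apply/measurable_EFinP.
  exact: (measurableT_comp (measurable_powR p) mg).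
have young x : (p * a `^ (p - 1) * g x <= g x `^ p + (p - 1) * a `^ p)%R.
  have := @conjugate_powR R (g x) (a `^ (p - 1))%R p (p / (p - 1))%R (g0 x) (powR_ge0 _ _) p0.
  rewrite -powRrM invf_div.
  have -> : ((p - 1) * (p / (p - 1)) = p)%R by field; lra.
  have pp0 : (0 < p / (p - 1))%R by apply: divr_gt0; lra.
  move=> /(_ pp0).
  have -> : (p^-1 + (p - 1) / p = 1)%R by field; lra.
  move=> /(_ erefl); rewrite -(ler_pM2l p0).
  have -> : (p * (g x `^ p / p + a `^ p * ((p - 1) / p)) = g x `^ p + (p - 1) * a `^ p)%R.
    by field; lra.
  lra.
have H : \int[mu]_(x in D) ((p * a `^ (p - 1))%:E * (g x)%:E) <=
    \int[mu]_(x in D) ((g x `^ p)%:E + ((p - 1) * a `^ p)%:E).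
  apply: ge0_integral_mono => x _; last by rewrite -EFinM -EFinD lee_fin.
  by rewrite -EFinM lee_fin !mulr_ge0 ?powR_ge0// ltW.
have E1 : \int[mu]_(x in D) ((p * a `^ (p - 1))%:E * (g x)%:E) =
    (p * a `^ (p - 1))%:E * (a * m)%:E.
  rewrite ge0_integralZl_EFin ?Dg// => [x _|]; first by rewrite lee_fin.
  by rewrite mulr_ge0 ?powR_ge0// ltW.
have E2 : \int[mu]_(x in D) ((g x `^ p)%:E + ((p - 1) * a `^ p)%:E) =
    \int[mu]_(x in D) (g x `^ p)%:E + ((p - 1) * a `^ p)%:E * m%:E.
  rewrite ge0_integralD// => [|x _|x _]; first by rewrite integral_cst// muD.
    by rewrite lee_fin powR_ge0.
  by rewrite lee_fin mulr_ge0 ?powR_ge0//; lra.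
rewrite E1 E2 in H.
have ap := mulr_powRB1 a0 p0.
have I0 : 0 <= \int[mu]_(x in D) (g x `^ p)%:E.
  by apply: integral_ge0 => x _; rewrite lee_fin powR_ge0.
move: H I0; case: (\int[mu]_(x in D) (g x `^ p)%:E) => [I H _|_ _|] //.
  move: H; rewrite -!EFinM -EFinD !lee_fin -ap.
  set b := (a `^ (p - 1))%R => H.
  by have : (p * b * (a * m) = p * (a * b) * m)%R by [ring]; lra.
by rewrite leey.
Qed.

(** * From the grid to R^d *)

Section grid_cells.
Context {R : realType} {d : nat}.
Local Notation Rd := (Rd R d).
Local Notation leb := (leb R d).
Local Notation grid N := {ffun 'I_d -> 'I_N.+1}.
Local Notation cube a l := (dbox a (fun i => (a i + l i)%N)).
Variables (delta s : R).
Hypothesis delta0 : (0 < delta)%R.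

(** Half-open intervals make the cells disjoint. The shift [s] lets natural indices reach negative
    coordinates. *)
Definition grid_box (a b : 'I_d -> nat) : set Rd :=
  box (fun i => delta * ((a i)%:R - s))%R (fun i => delta * ((b i)%:R - s))%R
    (fun=> true) (fun=> true).

Definition cell N (x : grid N) : set Rd := grid_box (fun i => x i) (fun i => (x i).+1).

Lemma grid_boxP (a b : 'I_d -> nat) (y : Rd) : grid_box a b y <->
  forall i, ((a i)%:R <= tnth y i / delta + s < (b i)%:R)%R.
Proof.
have E i : (tnth y i \in Interval (BSide true (delta * ((a i)%:R - s)))
    (BSide true (delta * ((b i)%:R - s))))%R =
    ((a i)%:R <= tnth y i / delta + s < (b i)%:R)%R.
  rewrite in_itv /= -lerBlDr -ltrBrDr ler_pdivlMr// ltr_pdivrMr//.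
  by rewrite [((_ - s) * _)%R]mulrC [X in (_ && (_ < X)%R)]mulrC.
by split=> H i; have := H i; rewrite E.
Qed.

Lemma cell_inj N (x x' : grid N) y : cell x y -> cell x' y -> x = x'.
Proof.
move=> /grid_boxP xy /grid_boxP x'y; apply/ffunP => i; apply/val_inj => /=.
have /andP[a1 b1] := xy i; have /andP[a2 b2] := x'y i.
have h1 := le_lt_trans a1 b2; have h2 := le_lt_trans a2 b1.
rewrite !ltr_nat in h1 h2; apply/eqP; rewrite eqn_leq; lia.
Qed.

Lemma grid_box_cell N (a b : 'I_d -> nat) y : (forall i, b i <= N.+1)%N -> grid_box a b y ->
  exists2 x : grid N, x \in dbox a b & cell x y.
Proof.
move=> bN /grid_boxP yab; pose n i := Num.truncn (tnth y i / delta + s).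
have nP i : ((n i)%:R <= tnth y i / delta + s < (n i).+1%:R)%R.
  by apply: truncn_itv; have /andP[+ _] := yab i; apply: le_trans; rewrite ler0n.
have nab i : (a i <= n i < b i)%N.
  have /andP[h1 h2] := yab i; have /andP[h3 h4] := nP i.
  have := le_lt_trans h1 h4; have := le_lt_trans h3 h2.
  by rewrite !ltr_nat => -> h; rewrite -ltnS h.
have nN i : (n i < N.+1)%N by have /andP[_ h] := nab i; exact: leq_trans h (bN i).
exists [ffun i => Ordinal (nN i)]; first by apply/dboxP => i; rewrite ffunE.
by apply/grid_boxP => i; rewrite !ffunE; exact: nP.
Qed.

Lemma cell_sub N (a b : 'I_d -> nat) (x : grid N) : x \in dbox a b -> cell x `<=` grid_box a b.
Proof.
move=> /dboxP xab y /grid_boxP xy; apply/grid_boxP => i.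
have /andP[h1 h2] := xy i; have /andP[h3 h4] := xab i.
by rewrite (le_trans _ h1) ?ler_nat// (lt_le_trans h2)// ler_nat.
Qed.

Lemma measurable_grid_box a b : measurable (grid_box a b).
Proof. exact: measurable_box. Qed.

Lemma leb_grid_box N (a b : 'I_d -> nat) : (forall i, a i < b i)%N -> (forall i, b i <= N.+1)%N ->
  leb (grid_box a b) = (delta ^+ d * #|(dbox a b : {set grid N})|%:R)%:E.
Proof.
move=> ab bN; rewrite /grid_box leb_box => [|i]; last first.
  by rewrite ltr_pM2l// ltrD2r ltr_nat.
rewrite card_dbox// natr_prod -[X in (_ ^+ X)%R]card_ord -prodr_const -big_split /=.
by congr EFin; apply: eq_bigr => i _; rewrite natrB 1?ltnW//; ring.
Qed.

Lemma leb_cell N (x : grid N) : leb (cell x) = (delta ^+ d)%:E.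
Proof.
rewrite (@leb_grid_box N)// card_dbox// big1 ?mulr1// => i _; exact: subSnn.
Qed.

Lemma cell_finite_integral N (f : Rd -> R) (x : grid N) : loc_integrable f ->
  (\int[leb]_(y in cell x) `|f y|%:E) \is a fin_num.
Proof.
move=> [mf fK]; rewrite ge0_fin_numE; last by apply: integral_ge0 => y _; rewrite lee_fin.
pose a i := (delta * ((x i)%:R - s))%R; pose b i := (delta * ((x i).+1%:R - s))%R.
have := fK _ (@compactRd_box R d a b); apply: le_lt_trans.
apply: ge0_subset_integral; [exact: measurable_box|exact: measurable_box| | |].
- apply: measurable_funTS; apply/measurable_EFinP.
  exact: measurableT_comp.
- by move=> y _; rewrite lee_fin.
- by move=> y xy i; have := xy i; rewrite !in_itv /= => /andP[-> /ltW ->].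
Qed.

Lemma iter_maximal_ge0 (w : Rd -> \bar R) k y : (0 < k)%N -> 0 <= iter_maximal k w y.
Proof.
case: k => // k _ /=.
(* The supremum of an empty family would be [-oo]; the unit cube is a rectangle of every positive
   complexity. *)
pose Q : set Rd := box (fun=> 0%R) (fun=> 1%R) (fun=> true) (fun=> true).
apply: le_ereal_sup_tmp; exists ((\1_Q y)%:E * average (iter_maximal k w) Q).
  exists Q => //; exists (fun=> 0%R), (fun=> 1%R), (fun=> true), (fun=> true); split => //.
  exists (fun=> 1%R); split => // i; exists ord0; lra.
rewrite mule_ge0 ?lee_fin// /average mule_ge0//; last exact: integral_ge0.
rewrite leb_box// inver; case: ifP => // _.
by rewrite lee_fin invr_ge0 prodr_ge0// => i _; lra.
Qed.

Lemma rectangles_grid_box k (a l : 'I_d -> nat) : sidelengths k l ->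
  rectangles k (grid_box a (fun i => a i + l i)%N).
Proof.
move=> [alpha [alpha0 al]].
exists (fun i => delta * ((a i)%:R - s))%R, (fun i => delta * ((a i + l i)%:R - s))%R.
exists (fun=> true), (fun=> true); split; [|by []|].
- move=> i; rewrite ltr_pM2l// ltrD2r ltr_nat; have [j ->] := al i.
  by have := alpha0 j; lia.
- exists (fun j => delta * (alpha j)%:R)%R; split => [j|i].
    by rewrite mulr_gt0// ltr0n.
  by have [j ij] := al i; exists j; rewrite -ij natrD; ring.
Qed.

End grid_cells.

Section transfer.
Context {R : realType} {d : nat}.
Local Notation Rd := (Rd R d).
Local Notation leb := (leb R d).
Local Notation grid N := {ffun 'I_d -> 'I_N.+1}.
Local Notation cube a l := (dbox a (fun i => (a i + l i)%N)).
Variables (delta s : R) (N : nat).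
Hypothesis delta0 : (0 < delta)%R.
Local Notation grid_box := (@grid_box R d delta s).
Local Notation cell := (@cell R d delta s N).
Local Notation gcube a l := (grid_box a (fun i => (a i + l i)%N)).

Definition cell_mean (g : Rd -> R) (x : grid N) : R :=
  (fine (\int[leb]_(y in cell x) `|g y|%:E) / delta ^+ d)%R.

Lemma cell_mean_ge0 g x : (0 <= cell_mean g x)%R.
Proof.
rewrite /cell_mean divr_ge0 ?exprn_ge0 ?(ltW delta0)//.
by apply/fine_ge0/integral_ge0 => y _; rewrite lee_fin.
Qed.

Lemma cell_meanE g x : loc_integrable g ->
  \int[leb]_(y in cell x) `|g y|%:E = (delta ^+ d * cell_mean g x)%:E.
Proof.
move=> lg; have D0 : (delta ^+ d != 0)%R by rewrite expf_neq0// gt_eqF.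
rewrite /cell_mean mulrC divfK// fineK//; exact: cell_finite_integral.
Qed.

(* Lower bounds for the iterated maximal functions on the cells. For [k > 0] the infimum may be
   infinite, hence the truncation at [K]. *)
Definition cell_iter (K : R) (w : Rd -> R) (k : nat) (x : grid N) : R :=
  if k is 0 then cell_mean w x
  else fine (Order.min K%:E (ereal_inf [set iter_maximal k (EFin \o w) y | y in cell x])).

Section cell_iter.
Variables (w : Rd -> R) (K : R).
Hypotheses (ww : weight w) (wK : forall x, (cell_mean w x <= K)%R) (K0 : (0 <= K)%R).
Local Notation W k := (iter_maximal k (EFin \o w)).
Local Notation u := (cell_iter K w).

Lemma cell_iterE k x : (0 < k)%N ->
  (u k x)%:E = Order.min K%:E (ereal_inf [set W k y | y in cell x]).
Proof.
case: k => // k _; rewrite /cell_iter fineK// ge0_fin_numE.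
  by rewrite gt_min ltry.
rewrite le_min lee_fin K0 /=; apply: le_ereal_inf_tmp => _ [y _ <-].
exact: (@iter_maximal_ge0 R d (EFin \o w) k.+1 y).
Qed.

Lemma cell_iter_ge0 k x : (0 <= u k x)%R.
Proof.
case: k => [|k]; first exact: cell_mean_ge0.
rewrite -lee_fin cell_iterE// le_min lee_fin K0 /=; apply: le_ereal_inf_tmp => _ [y _ <-].
exact: (@iter_maximal_ge0 R d (EFin \o w) k.+1 y).
Qed.

Lemma cell_iter_le k x y : (0 < k)%N -> cell x y -> (u k x)%:E <= W k y.
Proof.
move=> k0 xy; rewrite cell_iterE// ge_min; apply/orP; right.
by apply: ereal_inf_lbound; exists y.
Qed.

Lemma cell_iter_leK k x : (u k x <= K)%R.
Proof.
case: k => [|k]; first exact: wK.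
by rewrite -lee_fin cell_iterE// ge_min lexx.
Qed.

Lemma iter_maximal_nneg k y : 0 <= W k y.
Proof.
case: k => [|k]; last exact: (@iter_maximal_ge0 R d (EFin \o w) k.+1 y).
by rewrite lee_fin; have [] := ww.
Qed.

(** For [k = 0] the cell means reproduce the integral of [w] exactly; for [k > 0] the function [u k]
    is on each cell a constant below [W k]. *)
Lemma sum_cell_iter_le k (a l : 'I_d -> nat) : (forall i, a i + l i <= N.+1)%N ->
  (delta ^+ d * \sum_(x in cube a l) u k x)%:E <= \int[leb]_(y in gcube a l) `|W k y|.
Proof.
move=> alN.
have disj (x x' : grid N) y : cell x y -> cell x' y -> x = x' by exact: cell_inj.
have mc x : measurable (cell x) by exact: measurable_grid_box.
have [w0 lw] := ww; have [mw _] := lw.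
rewrite mulr_sumr -sumEFin; case: k => [|k].
  rewrite (eq_bigr (fun x => 1%:E * \int[leb]_(y in cell x) `|w y|%:E)); last first.
    by move=> x _; rewrite mul1e cell_meanE.
  apply: (@sum_pieces_le_integral R _ _ leb _ _ mc (cube a l) _ (fun=> 1%R)
    (fun y => `|w y|%:E) (fun y => `|W 0 y|) disj) => [|y|x|y _|x xal|x y _ _].
  - by apply/measurable_EFinP; exact: measurableT_comp.
  - by rewrite lee_fin.
  - exact: ler01.
  - exact: abse_ge0.
  - exact: cell_sub.
  - by rewrite mul1e.
rewrite (eq_bigr (fun x => (u k.+1 x)%:E * \int[leb]_(y in cell x) 1)); last first.
  by move=> x _; rewrite integral_cst// mul1e leb_cell// -EFinM mulrC.
apply: (@sum_pieces_le_integral R _ _ leb _ _ mc (cube a l) _ (u k.+1)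
  (fun=> 1) (fun y => `|W k.+1 y|) disj) => [|y|x|y _|x xal|x y _ xy].
- exact: measurable_cst.
- exact: lee01.
- exact: cell_iter_ge0.
- exact: abse_ge0.
- exact: cell_sub.
- rewrite mule1 gee0_abs; last exact: iter_maximal_nneg.
  exact: cell_iter_le.
Qed.

(** Both entries of the minimum defining [u k.+1] dominate the average: [K], because [u k] is at
    most [K], and the infimum over the cell, because the grid box is a rectangle containing the
    cell. *)
Lemma averages_below_cell_iter c : averages_below c u.
Proof.
move=> k a l x _ sl alN xal.
have l0 i : (a i < a i + l i)%N by have := @complexity_gt0 d k.+1 l sl i; lia.
have Q0 : (0 < #|(cube a l : {set grid N})|%:R :> R)%R.
  by rewrite ltr0n; apply/card_gt0P; exists x.
rewrite mulrC -ler_pdivrMr// -lee_fin cell_iterE// le_min; apply/andP; split.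
  rewrite lee_fin ler_pdivrMr// mulr_natr -sumr_const; apply: ler_sum => y _.
  exact: cell_iter_leK.
apply: le_ereal_inf_tmp => _ [y xy <-].
apply: le_ereal_sup_tmp; exists ((\1_(gcube a l) y)%:E * average (W k) (gcube a l)).
  by exists (gcube a l) => //; exact: rectangles_grid_box.
rewrite indicE mem_set; last exact: cell_sub xy.
rewrite mul1e /average (@leb_grid_box R d delta s delta0 N)// inver.
have dQ : (0 < delta ^+ d * #|(cube a l : {set grid N})|%:R)%R.
  by rewrite mulr_gt0// exprn_gt0.
rewrite gt_eqF//.
apply: le_trans (lee_wpmul2l _ (sum_cell_iter_le k alN)); last first.
  by rewrite lee_fin invr_ge0 ltW.
rewrite -EFinM lee_fin invfM -mulrA mulrCA mulKf ?lexx//.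
  by rewrite mulrC.
by rewrite gt_eqF// exprn_gt0.
Qed.

End cell_iter.

(** On the left [E] is covered by the cells meeting it. On the right Jensen's inequality bounds the
    powers of the cell means of [f], and [cell_iter] is a lower bound of the iterated maximal
    function. *)
Lemma grid_transfer (M c : nat) (p C t : R) (w f : Rd -> R) (E : set Rd) :
  N.+1 = (3 * M)%N -> (1 < p)%R -> (0 < c)%N -> (0 <= C)%R -> (0 < t)%R ->
  grid_weak_type (d := d) p c C (fun=> True) -> weight w -> loc_integrable f ->
  (forall y, E y -> exists a l, [/\ central M a l, sidelengths c l, gcube a l y &
     t%:E * leb (gcube a l) <= \int[leb]_(z in gcube a l) `|f z|%:E]) ->
  (t `^ p)%:E * \int[leb]_(y in E) (w y)%:E <=
  C%:E * \int[leb]_y ((`|f y| `^ p)%:E * iter_maximal c (EFin \o w) y).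
Proof.
move=> NM p1 c0 C0 t0 gw ww lf HE.
have [w0 lw] := ww; have [mw _] := lw; have [mf _] := lf.
have disj (x x' : grid N) y : cell x y -> cell x' y -> x = x' by exact: cell_inj.
have mc x : measurable (cell x) by exact: measurable_grid_box.
have D0 : (0 < delta ^+ d)%R by exact: exprn_gt0.
pose K := (\sum_x cell_mean w x)%R.
have wK x : (cell_mean w x <= K)%R.
  by rewrite /K (bigD1 x)//= lerDl sumr_ge0// => y _; exact: cell_mean_ge0.
have K0 : (0 <= K)%R by rewrite sumr_ge0// => y _; exact: cell_mean_ge0.
pose T : {set grid N} := [set x | `[< exists2 y, E y & cell x y >]]%SET.
have mabs (g : Rd -> R) : measurable_fun [set: Rd] g ->
    measurable_fun [set: Rd] (fun y => `|g y|%:E).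
  by move=> mg; apply/measurable_EFinP; exact: measurableT_comp.
have upper : \int[leb]_(y in E) (w y)%:E <=
    (delta ^+ d * \sum_(x in T) cell_iter K w 0 x)%:E.
  have := @integral_le_sum_pieces R _ _ leb _ _ mc T E (fun y => `|w y|%:E) (mabs _ mw).
  rewrite mulr_sumr -sumEFin (eq_bigr _ (fun x _ => cell_meanE x lw)) => H.
  under eq_integral do rewrite -(ger0_norm (w0 _)).
  apply: H => [//|y Ey]; have [a [l [cen _ ay _]]] := HE y Ey.
  have [|x xal xy] := @grid_box_cell R d delta s delta0 N _ _ y _ ay.
    by move=> i; have := cen i; move: NM; clear; lia.
  by exists x => //; rewrite inE; apply/asboolP; exists y.
(* A cell that meets a grid box is contained in it, so the heavy box found at one point of [E]
   serves for the whole cell. *)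
have heavy x : x \in T ->
    in_heavy_box M (cell_mean f) t (fun l => complexity c l /\ True) x.
  rewrite inE => /asboolP[y Ey xy]; have [a [l [cen sl ay tf]]] := HE y Ey.
  have alN i : (a i + l i <= N.+1)%N by have := cen i; move: NM; clear; lia.
  have [x' xal x'y] := @grid_box_cell R d delta s delta0 N _ _ y alN ay.
  rewrite (disj _ _ _ x'y xy) in xal.
  have cl : complexity c l by case: (c) c0 sl.
  exists a, l; split => //.
  have l0 i : (a i < a i + l i)%N by have := complexity_gt0 cl i; clear; lia.
  rewrite -(ler_pM2l D0) -lee_fin mulrCA EFinM -(@leb_grid_box R d delta s delta0 N)//.
  apply: (le_trans tf); rewrite mulr_sumr -sumEFin -(eq_bigr _ (fun x _ => cell_meanE x lf)).
  apply: (@integral_le_sum_pieces R _ _ leb _ _ mc (cube a l)) => [|//|z az].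
    exact: mabs.
  exact: grid_box_cell az.
have main := gw N M (cell_iter K w) (cell_mean f) t T NM (cell_iter_ge0 w K0)
  (averages_below_cell_iter ww wK K0 (c := c)) (cell_mean_ge0 f) t0 heavy.
apply: (le_trans (lee_wpmul2l _ upper)); first by rewrite lee_fin powR_ge0.
rewrite -EFinM mulrCA.
apply: (@le_trans _ _ (delta ^+ d * (C * \sum_x cell_mean f x `^ p * cell_iter K w c x))%:E).
  by rewrite lee_fin ler_pM2l.
rewrite mulrCA EFinM; apply: lee_wpmul2l; first by rewrite lee_fin.
have mfp : measurable_fun [set: Rd] (fun y => (`|f y| `^ p)%:E).
  apply/measurable_EFinP; apply: (measurableT_comp (measurable_powR p)).
  exact: measurableT_comp.
apply: (@le_trans _ _ (\sum_(x in [set: grid N]%SET)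
    (cell_iter K w c x)%:E * \int[leb]_(y in cell x) (`|f y| `^ p)%:E)).
  rewrite mulr_sumr -sumEFin.
  rewrite [leRHS](eq_bigl xpredT); last by move=> x; rewrite inE.
  apply: lee_sum => x _; set F := cell_mean f x; set v := cell_iter K w c x.
  have -> : (delta ^+ d * (F `^ p * v) = v * (F `^ p * delta ^+ d))%R by ring.
  rewrite EFinM.
  apply: lee_wpmul2l; first by rewrite lee_fin cell_iter_ge0.
  have nf : measurable_fun [set: Rd] (fun y => `|f y|%R) by exact: measurableT_comp.
  have fE : \int[leb]_(y in cell x) `|f y|%:E = (F * delta ^+ d)%:E.
    by rewrite mulrC; exact: cell_meanE.
  have D x' : leb (cell x') = (delta ^+ d)%:E by exact: leb_cell.
  exact: (powR_integral_le p1 (mc x) (D x) nf (fun y => normr_ge0 (f y))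
    (cell_mean_ge0 f x) fE).
apply: (@sum_pieces_le_integral R _ _ leb _ _ mc [set: grid N]%SET _ (cell_iter K w c)
  (fun y => (`|f y| `^ p)%:E) _ disj) => [|y|x|y _|x xal|x y _ xy].
- exact: mfp.
- by rewrite lee_fin powR_ge0.
- exact: cell_iter_ge0.
- by rewrite mule_ge0 ?lee_fin ?powR_ge0//; exact: iter_maximal_nneg.
- by [].
- rewrite muleC; apply: lee_wpmul2l; first by rewrite lee_fin powR_ge0.
  exact: cell_iter_le.
Qed.

End transfer.

(** * Exhaustion of the superlevel set by heavy dyadic boxes *)

Section dyadic.
Context {R : realType} {d : nat}.
Local Notation Rd := (Rd R d).
Local Notation leb := (leb R d).
Variables (c : nat) (f : Rd -> R) (t : R).
Hypotheses (lf : loc_integrable f) (t0 : (0 < t)%R).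

Definition mesh n : R := (2 ^- n)%R.

(** The middle index of a grid with [6 * 4 ^ n] points in each direction, which becomes the
    origin. *)
Definition shift n : R := (3 * 4 ^ n)%:R.

Local Notation gcube n a l := (@grid_box R d (mesh n) (shift n) a (fun i => (a i + l i)%N)).

(* The central boxes of the [n]-th grid are the dyadic boxes in [-2^n, 2^n)^d. *)
Definition heavy_union n : set Rd :=
  [set y | exists a l, [/\ central (2 * 4 ^ n) a l, sidelengths c l, gcube n a l y &
     t%:E * leb (gcube n a l) <= \int[leb]_(z in gcube n a l) `|f z|%:E]].

Lemma mesh_gt0 n : (0 < mesh n)%R.
Proof. by rewrite invr_gt0 exprn_gt0. Qed.

Lemma heavy_union_nondecreasing : nondecreasing_seq heavy_union.
Proof.
apply/nondecreasing_seqP => n; apply/subsetPset => y [a [l [cen sl yal tl]]].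
(* Halving the mesh doubles indices counted from the middle, which itself moves from [3 * 4 ^ n] to
   [12 * 4 ^ n]. *)
pose a' i := (2 * a i + 6 * 4 ^ n)%N; pose l' i := (2 * l i)%N.
have E : gcube n a l = gcube n.+1 a' l'.
  have m2 : mesh n = (2 * mesh n.+1)%R.
    by rewrite /mesh exprS invfM mulrA divff ?mul1r.
  have s4 : shift n.+1 = (4 * shift n)%R by rewrite /shift -natrM expnS; congr _%:R; lia.
  have s3 : (6 * 4 ^ n)%:R = (2 * shift n)%R by rewrite /shift -natrM; congr _%:R; lia.
  rewrite /grid_box m2 s4 /a' /l'; congr (box _ _ _ _); apply/funext => i.
    by rewrite natrD natrM s3; ring.
  have -> : (2 * a i + 6 * 4 ^ n + 2 * l i = 2 * (a i + l i) + 6 * 4 ^ n)%N by lia.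
  by rewrite (natrD _ (2 * (a i + l i))) natrM s3; ring.
exists a', l'; split; rewrite -?E//.
- move=> i; have := cen i; rewrite /a' /l' expnS; clear; lia.
- have [alpha [alpha0 al]] := sl.
  exists (fun j => 2 * alpha j)%N; split => [j|i]; first by rewrite muln_gt0 /=.
  by have [j ij] := al i; exists j; rewrite /l' ij.
Qed.

Lemma measurable_heavy_union n : measurable (heavy_union n).
Proof.
(* A central box has corner and sidelengths at most [K], so the union is finite. *)
pose K := (4 * 4 ^ n)%N.
pose I := ({ffun 'I_d -> 'I_K.+1} * {ffun 'I_d -> 'I_K.+1})%type.
pose P (q : I) := [/\ central (2 * 4 ^ n) (fun i => q.1 i) (fun i => q.2 i),
  sidelengths c (fun i => q.2 i) &
  t%:E * leb (gcube n (fun i => q.1 i) (fun i => q.2 i)) <=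
    \int[leb]_(z in gcube n (fun i => q.1 i) (fun i => q.2 i)) `|f z|%:E].
have -> : heavy_union n = \bigcup_(q in [set q | P q]) gcube n (fun i => q.1 i) (fun i => q.2 i).
  apply/seteqP; split => [y [a [l [cen sl yal tl]]]|y [q [cen sl tl] yq]]; last first.
    by exists (fun i => q.1 i), (fun i => q.2 i); split.
  have aK i : (a i < K.+1)%N by have := cen i; rewrite /K; clear; lia.
  have lK i : (l i < K.+1)%N by have := cen i; rewrite /K; clear; lia.
  pose q : I := ([ffun i => Ordinal (aK i)], [ffun i => Ordinal (lK i)]).
  have q1 : (fun i => nat_of_ord (q.1 i)) = a by apply/funext => i; rewrite ffunE.
  have q2 : (fun i => nat_of_ord (q.2 i)) = l by apply/funext => i; rewrite ffunE.
  have q12 : (fun i => q.1 i + q.2 i)%N = (fun i => a i + l i)%N.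
    by apply/funext => i; rewrite !ffunE.
  by exists q; rewrite /P /mkset q1 q12 ?q2.
apply: fin_bigcup_measurable => [|q _]; first exact: finite_finset.
exact: measurable_grid_box.
Qed.

(** The enlarged product is a polynomial in [x], hence continuous at 0. *)
Lemma prod_enlarge_lt (l : 'I_d -> R) (v : R) : (\prod_i l i < v)%R ->
  exists2 e : R, (0 < e)%R & forall x, (0 <= x < e)%R -> (\prod_i (l i + x) < v)%R.
Proof.
move=> lv; pose q : {poly R} := (\prod_i ((l i)%:P + 'X))%R.
have qE x : q.[x]%R = (\prod_i (l i + x))%R.
  by rewrite horner_prod; apply: eq_bigr => i _; rewrite hornerD hornerC hornerX.
have q0 : (q.[0] < v)%R by rewrite qE; under eq_bigr do rewrite addr0.
have /nbhs_ballP[e /= e0 He] : \forall x \near (0%R : R), (q.[x] < v)%R.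
  by apply: (cvgr_lt _ (@continuous_horner R q 0%R)).
exists e => // x /andP[x0 xe]; rewrite -qE; apply: He.
by rewrite /ball /= sub0r normrN ger0_norm.
Qed.

(** The strict inequality for the average over [Q] leaves room to enlarge [Q] to a dyadic box. The
    rounding of a side depends only on its length, so equal sides stay equal and the complexity is
    preserved. *)
Lemma superlevel_sub : [set y | t%:E < maximal c (EFin \o f) y] `<=` \bigcup_n heavy_union n.
Proof.
move=> y /= /ereal_sup_gt[_ [Q [a [b [l [r [ab QE [alpha [alpha0 bal]]]]]]] <-] tQ].
have yQ : Q y.
  apply: contrapT => nyQ; move: tQ; rewrite indicE memNset// mul0e lte_fin.
  by rewrite ltNge (ltW t0).
move: tQ; rewrite indicE mem_set// mul1e /average.
have [k kE] := choice bal.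
have abE i : (b i - a i = alpha (k i))%R := kE i.
pose V := (\prod_i (b i - a i))%R.
have V0 : (0 < V)%R by apply: prodr_gt0 => i _; rewrite subr_gt0.
have lebQ : leb Q = V%:E by rewrite QE leb_box.
rewrite lebQ inver gt_eqF// lte_pdivlMl// => tI.
set I := \int[leb]_(z in Q) _ in tI.
(* [v] is the volume that the enlarged box may have while its average of [f] stays at least [t]. *)
have [v Vv vI] : exists2 v : R, (V < v)%R & (t * v)%:E <= I.
  move: tI; case: I => [I| |] // tI.
    exists (I / t)%R; last by rewrite mulrC divfK// gt_eqF.
    by rewrite ltr_pdivlMr// -lte_fin EFinM.
  by exists (V + 1)%R; [rewrite ltrDl|rewrite leey].
have [e e0 He] := prod_enlarge_lt Vv.
(* If 2^n exceeds [B], then twice the mesh is below [e] and the enlarged box still fits into the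
   central region. *)
pose B := (2 / e + \sum_i (`|a i| + (b i - a i)) + 2)%R.
have S0 : (0 <= \sum_i (`|a i| + (b i - a i)))%R.
  by apply: sumr_ge0 => i _; rewrite addr_ge0// subr_ge0 ltW.
have Bi i : (2 / e + `|a i| + (b i - a i) + 2 <= B)%R.
  rewrite /B (bigD1 i)//=; set s := (\sum_(j | _) _)%R.
  have : (0 <= s)%R by apply: sumr_ge0 => j _; rewrite addr_ge0// subr_ge0 ltW.
  by lra.
have e20 : (0 < 2 / e)%R by rewrite divr_gt0.
pose n := Num.bound B; pose D : R := (2 ^+ n)%R.
have BD : (B < D)%R.
  apply: lt_trans (archi_boundP _) _; first by rewrite /B; lra.
  by rewrite /D -natrX ltr_nat ltn_expl.
have D0 : (0 < D)%R by exact: exprn_gt0.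
have mD : (mesh n)^-1%R = D by rewrite /mesh invrK.
have m0 := mesh_gt0 n.
have Dm : (D * mesh n = 1)%R by rewrite /mesh mulfV// gt_eqF.
have sD : shift n = (3 * D * D)%R.
  by rewrite /shift natrM -mulrA; congr (_ * _)%R; rewrite -expr2 -exprM mulnC exprM natrX; congr (_ ^+ _)%R; lra.
have D2 : ((4 ^ n)%:R = D * D :> R)%R.
  by rewrite -expr2 -exprM mulnC exprM natrX; congr (_ ^+ _)%R; lra.
have em : (2 * mesh n < e)%R.
  have : (2 / e < D)%R by apply: le_lt_trans BD; rewrite /B; lra.
  by rewrite ltr_pdivrMr// => De; rewrite -(ltr_pM2l D0) mulrCA Dm mulr1.
(* The left endpoint is rounded down. Of the two extra units in [l'], one makes up for this and one
   for rounding down the length; a side grows by at most twice the mesh. *)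
pose a' i := Num.truncn (a i * D + shift n)%R.
pose l' i := (Num.truncn (alpha (k i) * D)).+2.
have aD i : (2 * D * D <= a i * D + shift n)%R.
  rewrite sD; have := Bi i; have := ab i; have := ler_norm (- a i); rewrite normrN => h1 h2 h3.
  have h4 : (- a i <= D)%R by lra.
  nra.
have a'P i : ((a' i)%:R <= a i * D + shift n < (a' i)%:R + 1)%R.
  by rewrite natr1 truncn_itv//; apply: le_trans (aD i); rewrite !mulr_ge0// ltW.
have l'P i : ((l' i)%:R - 2 <= (b i - a i) * D < (l' i)%:R - 1)%R.
  have : ((Num.truncn (alpha (k i) * D))%:R <= alpha (k i) * D <
     (Num.truncn (alpha (k i) * D)).+1%:R)%R.
    by apply: truncn_itv; rewrite mulr_ge0 ?ltW.
  by rewrite /l' abE -addn2 natrD -natr1 => /andP[h1 h2]; apply/andP; split; lra.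
have cen : central (2 * 4 ^ n) a' l'.
  move=> i; split.
    rewrite /a' truncn_ge_nat; last by apply: le_trans (aD i); rewrite !mulr_ge0// ltW.
    by rewrite natrM D2 mulrA.
  rewrite -(ler_nat R) natrD natrM natrM D2.
  have /andP[h1 _] := a'P i; have /andP[h2 _] := l'P i.
  have h3 := Bi i; have h4 := ler_norm (a i); rewrite sD in h1.
  have h5 : ((a i + (b i - a i) + 2) * D <= D * D)%R by rewrite ler_pM2r//; lra.
  have h6 : (1 <= D)%R by rewrite exprn_ege1// ler1n.
  nra.
have sl : sidelengths c l'.
  exists (fun j => (Num.truncn (alpha j * D)).+2); split => // i.
  by exists (k i).
have sub : Q `<=` gcube n a' l'.
  rewrite QE => z zQ; apply/grid_boxP => // i; rewrite mD.
  have /andP[h1 h2] := a'P i; have /andP[h3 h4] := l'P i.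
  have /andP[az zb] : (a i <= tnth z i <= b i)%R.
    move: (zQ i); rewrite in_itv; case: (l i) (r i) => [] [] /=;
      by move=> /andP[x1 x2]; rewrite ?(ltW x1) ?(ltW x2) ?x1 ?x2.
  have h5 := ler_wpM2r (ltW D0) az; have h6 := ler_wpM2r (ltW D0) zb.
  by rewrite natrD; apply/andP; split; lra.
exists n => //; exists a', l'; split => //; first exact: sub.
have l'0 i : (a' i < a' i + l' i)%N by rewrite -[X in (X < _)%N]addn0 ltn_add2l.
have IQ : I <= \int[leb]_(z in gcube n a' l') `|f z|%:E.
  have [mf _] := lf; apply: ge0_subset_integral => [||||].
  - by rewrite QE; exact: measurable_box.
  - exact: measurable_grid_box.
  - by apply: measurable_funTS; apply/measurable_EFinP; exact: measurableT_comp.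
  - by move=> z _; rewrite lee_fin.
  - exact: sub.
apply: le_trans (le_trans _ vI) IQ.
rewrite /grid_box leb_box => [|i]; last first.
  by rewrite ltr_pM2l// ltrD2r ltr_nat.
rewrite -EFinM lee_fin ler_pM2l//.
have h : (\prod_i ((b i - a i) + 2 * mesh n) < v)%R by apply: He; rewrite em andbT mulr_ge0// ltW.
apply: le_trans (ltW h); apply: ler_prod => i _; apply/andP; split.
  by rewrite -mulrBr mulr_ge0 ?(ltW m0)// natrD; have := ler0n R (l' i); lra.
have /andP[h1 _] := l'P i.
have h2 := ler_wpM2r (ltW m0) h1.
have h3 : ((b i - a i) * D * mesh n = b i - a i)%R by rewrite -mulrA Dm mulr1.
rewrite h3 in h2; rewrite natrD; lra.
Qed.

End dyadic.

(** * Passage to the limit over the dyadic grids *)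

Theorem theorem1p3 (R : realType) (d c : nat) (p : R) :
  (1 <= d)%N -> (1 <= c <= d)%N -> (1 < p)%R ->
  exists C : R, (0 < C)%R /\
    forall w : Rd R d -> R, weight w ->
    forall f : Rd R d -> R, loc_integrable f ->
    forall t : R, (0 < t)%R ->
      weighted_measure w [set x | t%:E < maximal c (EFin \o f) x] `^ p^-1
      <= (C / t)%:E * weighted_norm p (iter_maximal c (EFin \o w)) f.
Proof.
move=> d0 /andP[c0 _] p1; have [C [C0 HC]] := @grid_fefferman_stein R d c p d0 p1.
have p0 : (0 < p)%R by exact: lt_trans ltr01 p1.
have pn0 : p != 0%R by rewrite gt_eqF.
have C1 : (0 < C + 1)%R by rewrite ltr_wpDl.
(* [C] is only known to be nonnegative; adding 1 makes the constant positive. *)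
exists ((C + 1) `^ p^-1)%R; split; first exact: powR_gt0.
move=> w ww f lf t t0; have [w0 lw] := ww; have [mw _] := lw.
have tp : (0 < t `^ p)%R by exact: powR_gt0.
set W := iter_maximal c (EFin \o w).
set I := \int[leb R d]_y ((`|f y| `^ p)%:E * W y).
have W0 y : 0 <= W y by exact: iter_maximal_ge0.
have I0 : 0 <= I.
  by apply: integral_ge0 => y _; rewrite mule_ge0// lee_fin powR_ge0.
pose F n := heavy_union c f t n.
(* The grid constant is the same for all grids, so this bound is uniform in [n] and passes to the
   increasing union by monotone convergence. *)
have bound n : \int[leb R d]_(y in F n) (w y)%:E <= ((C + 1) / t `^ p)%:E * I.
  have NM : ((6 * 4 ^ n).-1.+1 = 3 * (2 * 4 ^ n))%N.
    by rewrite prednK ?muln_gt0 ?expn_gt0// mulnA.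
  have H := @grid_transfer R d (mesh n) (shift n) _ (@mesh_gt0 R n) _ c p C t w f (F n)
    NM p1 c0 C0 t0 HC ww lf (fun y => id).
  apply: (@le_trans _ _ ((t `^ p)^-1%:E * (C%:E * I))); first by rewrite lee_pdivlMl.
  rewrite muleA -EFinM; apply: lee_wpmul2r => //; rewrite lee_fin mulrC.
  by rewrite ler_wpM2r ?invr_ge0 ?(ltW tp)// lerDl.
have mF n : measurable (F n) by exact: measurable_heavy_union.
have wF : weighted_measure w [set x | t%:E < maximal c (EFin \o f) x] <=
    ((C + 1) / t `^ p)%:E * I.
  apply: (@le_trans _ _ (\int[leb R d]_(y in \bigcup_n F n) (w y)%:E)).
    rewrite /weighted_measure integral_mkcond [leRHS]integral_mkcond.
    apply: ge0_integral_mono => y _; rewrite !patchE.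
      by case: ifP => // _; rewrite lee_fin.
    case: ifPn => [|_]; last by case: ifP => // _; rewrite lee_fin.
    by rewrite inE => /(superlevel_sub lf t0) yF; rewrite mem_set.
  have cvF : \int[leb R d]_(y in F n) (w y)%:E @[n --> \oo] -->
      \int[leb R d]_(y in \bigcup_n F n) (w y)%:E.
    apply: ge0_nondecreasing_set_cvg_integral => [|//|n|n y _].
    - exact: heavy_union_nondecreasing.
    - by apply: measurable_funTS; exact/measurable_EFinP.
    - by rewrite lee_fin.
  by apply: cvge_le cvF; exact: nearW.
apply: (le_trans (gt0_ler_poweR _ _ _ wF)).
- by rewrite invr_ge0 ltW.
- by rewrite in_itv /= leey andbT integral_ge0// => y _; rewrite lee_fin.
- by rewrite in_itv /= leey andbT mule_ge0// lee_fin divr_ge0// ltW.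
rewrite poweRM//; last by rewrite lee_fin divr_ge0// ltW.
rewrite poweR_EFin powRM ?invr_ge0 ?powR_ge0 ?(ltW C1)//.
by rewrite -[((t `^ p)^-1)%R]powRN -powRrM mulNr mulfV// powR_inv1 ?(ltW t0).
Qed.
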